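(* Let $\Lambda$ be a row-finite $k$-graph without sources. Then all the spaces $\mathscr M(\Lambda)$, $\mathscr{PF}il(T_\Lambda)$, $\operatorname{Spec}_{\mathbb Z^k}(T_\Lambda)$, and $\operatorname{Spec}^{\mathrm{gr}}(\operatorname{KP}(\Lambda))$ are homeomorphic. Moreover, if $|\Lambda^0|<\infty$, then each of these spaces is spectral in the sense of Hochster.
   Context: $k\ge1$ is an integer, $\mathbb N\ni0$, $\mathbf e_1,\dots,\mathbf e_k$ are the standard generators of $\mathbb N^k$. A $k$-graph is a countable small category $\Lambda$ with a functor $d:\Lambda\to\mathbb N^k$ such that whenever $d(\lambda)=\mathbf m+\mathbf n$ there are unique $\alpha,\beta$ with $d(\alpha)=\mathbf m$, $d(\beta)=\mathbf n$, $\lambda=\alpha\beta$. Objects are identified with $\Lambda^0=d^{-1}(0)$; $r,s$ denote codomain and domain; $v\Lambda^{\mathbf n}=\{\lambda: d(\lambda)=\mathbf n,\ r(\lambda)=v\}$; $v\Lambda w=\{\lambda: r(\lambda)=v,\ s(\lambda)=w\}$. $\Lambda$ is row-finite if every $v\Lambda^{\mathbf n}$ is finite, and without sources if every $v\Lambda^{\mathbf n}$ is nonempty. A nonempty $M\subseteq\Lambda^0$ is a maximal tail if: (MT1) $w\in M$, $v\Lambda w\ne\emptyset$ imply $v\in M$; (MT2) for $v\in M$, $1\le i\le k$ there is $\lambda\in v\Lambda^{\mathbf e_i}$ with $s(\lambda)\in M$; (MT3) for $u,v\in M$ there is $w\in M$ with $u\Lambda w,v\Lambda w\neq\emptyset$.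 The set $\mathscr M(\Lambda)$ of maximal tails has the topology whose closed sets are $F_S=\{M\in\mathscr M(\Lambda): M\subseteq\bigcup_{N\in S}N\}$, $S\subseteq\mathscr M(\Lambda)$. The talented monoid $T_\Lambda$ is the commutative monoid generated by $v(\mathbf n)$ ($v\in\Lambda^0$, $\mathbf n\in\mathbb Z^k$) subject to $v(\mathbf n)=\sum_{\alpha\in v\Lambda^{\mathbf m}}s(\alpha)(\mathbf n+\mathbf m)$ for $v\in\Lambda^0,\mathbf n\in\mathbb Z^k,\mathbf m\in\mathbb N^k$, with $\mathbb Z^k$ acting by ${}^{\mathbf q}v(\mathbf n)=v(\mathbf n+\mathbf q)$ and $\mathbb N[\mathbb Z^k]$ by ${}^{(\sum n_i\mathbf q_i)}x=\sum n_i\,{}^{\mathbf q_i}x$. $x\le y$ iff $y=x+z$ for some $z$. A $\mathbb Z^k$-order ideal is a submonoid that is a down-set for $\le$ and closed under $\mathbb Z^k$. A proper $\mathbb Z^k$-order ideal $P$ is prime if for $\mathbb Z^k$-order ideals $J_1,J_2$, $J_1\cap J_2\subseteq P$ implies $J_1\subseteq P$ or $J_2\subseteq P$. $\operatorname{Spec}_{\mathbb Z^k}(T_\Lambda)$ is the set of these, with closed sets $\{P:J\subseteq P\}$, $J$ a $\mathbb Z^k$-order ideal. A nonempty $\mathcal F\subseteq T_\Lambda$ is a $\mathbb Z^k$-filter if (F1) $0\notin\mathcal F$ and $\mathcal F$ is $\mathbb Z^k$-closed; (F2) $x\in\mathcal F$, $y\ge x$ imply $y\in\mathcal F$; (F3)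 for $x,y\in\mathcal F$ there are $\alpha,\beta\in\mathbb N[\mathbb Z^k]$, $z\in\mathcal F$ with ${}^\alpha x,{}^\beta y\ge z$; it is prime if $x+y\in\mathcal F$ implies $x\in\mathcal F$ or $y\in\mathcal F$. $\mathscr{PF}il(T_\Lambda)$, the set of prime $\mathbb Z^k$-filters, has the topology with basis $\{\mathcal F: J\cap\mathcal F\neq\emptyset\}$, $J$ a $\mathbb Z^k$-order ideal. $\operatorname{KP}(\Lambda)$ is the universal associative algebra over a fixed arbitrary field generated by $p_v$ ($v\in\Lambda^0$), $s_\lambda,s_{\lambda^*}$ ($\lambda\in\Lambda\setminus\Lambda^0$) subject to: $p_up_v=\delta_{u,v}p_u$; $s_\lambda s_\mu=s_{\lambda\mu}$, $s_{\mu^*}s_{\lambda^*}=s_{(\lambda\mu)^*}$ when $s(\lambda)=r(\mu)$; $p_{r(\lambda)}s_\lambda=s_\lambda=s_\lambda p_{s(\lambda)}$, $p_{s(\lambda)}s_{\lambda^*}=s_{\lambda^*}=s_{\lambda^*}p_{r(\lambda)}$; $s_{\lambda^*}s_\mu=\delta_{\lambda,\mu}p_{s(\lambda)}$ when $d(\lambda)=d(\mu)$; $p_v=\sum_{\lambda\in v\Lambda^{\mathbf n}}s_\lambda s_{\lambda^*}$ for $\mathbf n\ne0$. It is $\mathbb Z^k$-graded with $p_v$, $s_\lambda$, $s_{\lambda^*}$ of degrees $0$, $d(\lambda)$, $-d(\lambda)$. A graded ideal $I$ satisfies $I=\bigoplus_{\mathbf n}(I\cap R_{\mathbf n})$. A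 proper graded ideal $P$ is graded prime if $IJ\subseteq P$ implies $I\subseteq P$ or $J\subseteq P$ for graded ideals $I,J$. $\operatorname{Spec}^{\mathrm{gr}}(R)$ is the set of graded prime ideals with closed sets $V^{\mathrm{gr}}(I)=\{P:I\subseteq P\}$, $I$ a graded ideal. A space is spectral in the sense of Hochster if it is compact (every open cover has a finite subcover), has a base of compact open sets closed under finite intersections, is $T_0$, and every nonempty irreducible closed set has a generic point. *)

(* Defs.v *)
From HB Require Import structures.
From mathcomp Require Import all_boot all_order all_algebra generic_quotient.
From mathcomp Require Import finmap.
From mathcomp Require Import all_classical.
From mathcomp Require Import topology.

Set Implicit Arguments.
Unset Strict Implicit.
Unset Printing Implicit Defensive.

Import GRing.Theory.

Local Open Scope classical_set_scope.
Local Open Scope quotient_scope.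
Local Open Scope ring_scope.

(* Composition is a total function, but it is only constrained on composable
   pairs, i.e. when src a = rng b; it is written in the order of functions
   ("comp a b" is the path ab, with range rng a and source src b). Countability
   of the category is carried by the countType structures. *)
Record kgraph (k : nat) := KGraph {
  vertex : countType;
  path : countType;
  rng : path -> vertex;
  src : path -> vertex;
  ident : vertex -> path;
  comp : path -> path -> path;
  deg : path -> 'rV[nat]_k;
  rng_ident : forall v, rng (ident v) = v;
  src_ident : forall v, src (ident v) = v;
  rng_comp : forall a b, src a = rng b -> rng (comp a b) = rng a;
  src_comp : forall a b, src a = rng b -> src (comp a b) = src b;
  comp_identl : forall a, comp (ident (rng a)) a = a;
  comp_identr : forall a, comp a (ident (src a)) = a;
  compA : forall a b c, src a = rng b -> src b = rng c ->
    comp a (comp b c) = comp (comp a b) c;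
  deg_ident : forall v, deg (ident v) = 0;
  deg_comp : forall a b, src a = rng b -> deg (comp a b) = deg a + deg b;
  unique_factorization : forall l m n, deg l = m + n ->
    exists! ab : path * path, [/\ src ab.1 = rng ab.2,
      deg ab.1 = m, deg ab.2 = n & l = comp ab.1 ab.2]
}.

Section KGraphNotions.
Context {k : nat} (L : kgraph k).

(* v L^n *)
Definition paths_from (v : vertex L) (n : 'rV[nat]_k) : set (path L) :=
  [set l | deg l = n /\ rng l = v].

(* v L w *)
Definition paths_between (v w : vertex L) : set (path L) :=
  [set l | rng l = v /\ src l = w].

Definition row_finite := forall v n, finite_set (paths_from v n).

Definition without_sources := forall v n, paths_from v n !=set0.

End KGraphNotions.

Definition zdeg {k : nat} (n : 'rV[nat]_k) : 'rV[int]_k := map_mx Posz n.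

Section MaximalTails.
Context {k : nat} (L : kgraph k).

Definition is_maximal_tail (M : set (vertex L)) :=
  [/\ M !=set0,
      forall v w, M w -> paths_between v w !=set0 -> M v,
      forall v (i : 'I_k), M v ->
        exists2 l, paths_from v (delta_mx 0 i) l & M (src l) &
      forall u v, M u -> M v ->
        exists w, [/\ M w, paths_between u w !=set0 & paths_between v w !=set0]].

Record maximal_tail := MaximalTail {
  tail_set :> set (vertex L);
  tail_prop : is_maximal_tail tail_set }.

HB.instance Definition _ := gen_eqMixin maximal_tail.
HB.instance Definition _ := gen_choiceMixin maximal_tail.

Definition tails_below (S : set maximal_tail) : set maximal_tail :=
  [set M : maximal_tail | M `<=` \bigcup_(N in S) (N : set (vertex L))].

Definition tails_open : set_system maximal_tail :=
  [set A | exists S, ~` A = tails_below S].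

Lemma tails_openT : tails_open setT.
Proof.
exists set0; rewrite setCT; apply/seteqP; split=> // M.
by have [[v Mv] _ _ _] := tail_prop M; case/(_ v Mv).
Qed.

Lemma tails_openI : setI_closed tails_open.
Proof.
move=> A B [S AS] [S' BS]; exists (S `|` S'); rewrite setCI AS BS.
apply/seteqP; split=> M; rewrite /tails_below /= bigcup_setU.
  by case=> MS v /MS Sv; [left | right].
have [_ MT1 _ MT3] := tail_prop M => MSS.
apply: contrapT => /not_orP [/existsNP [u /not_implyP [Mu Su]]].
move=> /existsNP [v /not_implyP [Mv S'v]].
have [w [Mw uw vw]] := MT3 _ _ Mu Mv.
case: (MSS w Mw) => -[N SN Nw].
- by apply: Su; exists N => //; have [_ H _ _] := tail_prop N; apply: (H _ w).
- by apply: S'v; exists N => //; have [_ H _ _] := tail_prop N; apply: (H _ w).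
Qed.

Lemma tails_open_bigcup (Idx : Type) (f : Idx -> set maximal_tail) :
  (forall i, tails_open (f i)) -> tails_open (\bigcup_i f i).
Proof.
move=> fo; rewrite /tails_open /= setC_bigcup; exists (\bigcap_i ~` f i).
apply/seteqP; split=> M.
  by move=> fM v Mv; exists M.
move=> MS i _; have [S fS] := fo i; rewrite fS => v Mv.
by have [N /(_ i I) + Nv] := MS v Mv; rewrite fS; apply.
Qed.

HB.instance Definition _ := isOpenTopological.Build maximal_tail
  tails_openT tails_openI tails_open_bigcup.

End MaximalTails.

(* The commutative monoid presented by generators X and relations R: terms
   modulo the least congruence containing R and the monoid laws. *)
Inductive mon_term (X : Type) :=
| MonGen of X
| MonZero
| MonAdd of mon_term X & mon_term X.
Arguments MonZero {X}.

HB.instance Definition _ (X : Type) := gen_eqMixin (mon_term X).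
HB.instance Definition _ (X : Type) := gen_choiceMixin (mon_term X).

Definition mon_sum {X : Type} (ts : seq (mon_term X)) : mon_term X :=
  foldr (@MonAdd X) MonZero ts.

Section PresentedMonoid.
Context {X : Type} (R : mon_term X -> mon_term X -> Prop).

Inductive mon_eq : mon_term X -> mon_term X -> Prop :=
| mon_rel t u : R t u -> mon_eq t u
| mon_refl t : mon_eq t t
| mon_sym t u : mon_eq t u -> mon_eq u t
| mon_trans t u w : mon_eq t u -> mon_eq u w -> mon_eq t w
| mon_add t t' u u' :
    mon_eq t t' -> mon_eq u u' -> mon_eq (MonAdd t u) (MonAdd t' u')
| mon_addA t u w : mon_eq (MonAdd t (MonAdd u w)) (MonAdd (MonAdd t u) w)
| mon_addC t u : mon_eq (MonAdd t u) (MonAdd u t)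
| mon_add0 t : mon_eq (MonAdd MonZero t) t.

Definition mon_eqb t u := `[< mon_eq t u >].

Lemma mon_eqb_refl : reflexive mon_eqb.
Proof. by move=> t; apply/asboolP; apply: mon_refl. Qed.

Lemma mon_eqb_sym : symmetric mon_eqb.
Proof. by move=> t u; apply/asboolP/asboolP; apply: mon_sym. Qed.

Lemma mon_eqb_trans : transitive mon_eqb.
Proof.
by move=> t u w /asboolP ut /asboolP tw; apply/asboolP; apply: mon_trans tw.
Qed.

Canonical mon_equiv := EquivRel mon_eqb mon_eqb_refl mon_eqb_sym mon_eqb_trans.

Definition presented_monoid := {eq_quot mon_equiv}.

HB.instance Definition _ := Choice.on presented_monoid.

Definition mon_class (t : mon_term X) : presented_monoid :=
  \pi_({eq_quot mon_equiv}) t.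

Definition mon_repr (x : presented_monoid) : mon_term X :=
  repr (x : {eq_quot mon_equiv}).

Lemma mon_reprK : cancel mon_repr mon_class.
Proof. exact: reprK. Qed.

Lemma mon_classP t u : mon_class t = mon_class u <-> mon_eq t u.
Proof.
split=> [/eqP|tu]; first by rewrite /mon_class eqmodE => /asboolP.
by apply/eqP; rewrite /mon_class eqmodE; apply/asboolP.
Qed.

Lemma mon_repr_class t : mon_eq (mon_repr (mon_class t)) t.
Proof. by apply/mon_classP; rewrite mon_reprK. Qed.

Definition pmon_zero : presented_monoid := mon_class MonZero.
Definition pmon_add (x y : presented_monoid) : presented_monoid :=
  mon_class (MonAdd (mon_repr x) (mon_repr y)).

Lemma pmon_add_class t u :
  mon_class (MonAdd t u) = pmon_add (mon_class t) (mon_class u).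
Proof. by apply/mon_classP; apply: mon_add; apply/mon_sym/mon_repr_class. Qed.

Lemma pmon_addA : associative pmon_add.
Proof.
move=> x y z; rewrite -(mon_reprK x) -(mon_reprK y) -(mon_reprK z).
by rewrite -!pmon_add_class; apply/mon_classP/mon_addA.
Qed.

Lemma pmon_addC : commutative pmon_add.
Proof. by move=> x y; apply/mon_classP/mon_addC. Qed.

Lemma pmon_add0 : left_id pmon_zero pmon_add.
Proof.
move=> x; rewrite -(mon_reprK x) /pmon_zero -pmon_add_class.
exact/mon_classP/mon_add0.
Qed.

HB.instance Definition _ :=
  GRing.isNmodule.Build presented_monoid pmon_addA pmon_addC pmon_add0.

Lemma mon_classD t u :
  mon_class (MonAdd t u) = mon_class t + mon_class u.
Proof. exact: pmon_add_class. Qed.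

End PresentedMonoid.

Section TalentedMonoid.
Context {k : nat} (L : kgraph k).

Definition tal_gen (v : vertex L) (n : 'rV[int]_k) := MonGen (v, n).

(* An enumeration e of v L^m exists exactly when v L^m is finite. *)
Inductive tal_rel : mon_term (vertex L * 'rV[int]_k) ->
    mon_term (vertex L * 'rV[int]_k) -> Prop :=
| TalRel v (n : 'rV[int]_k) (m : 'rV[nat]_k) (e : seq (path L)) :
    uniq e -> [set` e] = paths_from v m ->
    tal_rel (tal_gen v n)
            (mon_sum [seq tal_gen (src a) (n + zdeg m) | a <- e]).

Definition talented_monoid := presented_monoid tal_rel.

HB.instance Definition _ := GRing.Nmodule.on talented_monoid.

Fixpoint tal_shift (q : 'rV[int]_k) (t : mon_term (vertex L * 'rV[int]_k)) :=
  match t with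
  | MonGen (v, n) => tal_gen v (n + q)
  | MonZero => MonZero
  | MonAdd t u => MonAdd (tal_shift q t) (tal_shift q u)
  end.

Definition tal_act (q : 'rV[int]_k) (x : talented_monoid) : talented_monoid :=
  mon_class tal_rel (tal_shift q (mon_repr x)).

Lemma tal_shift_eq q t u :
  mon_eq tal_rel t u -> mon_eq tal_rel (tal_shift q t) (tal_shift q u).
Proof.
elim=> /=.
- move=> _ _ [v n m e ue eE] /=.
  have -> : tal_shift q (mon_sum [seq tal_gen (src a) (n + zdeg m) | a <- e])
      = mon_sum [seq tal_gen (src a) (n + q + zdeg m) | a <- e].
    by elim: (e) => //= a s ->; rewrite addrAC.
  exact/mon_rel/TalRel.
- by move=> t'; apply: mon_refl.
- by move=> t' u' _; apply: mon_sym.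
- by move=> t' u' w _ + _; apply: mon_trans.
- by move=> *; apply: mon_add.
- by move=> *; apply: mon_addA.
- by move=> *; apply: mon_addC.
- by move=> *; apply: mon_add0.
Qed.

Lemma tal_act_class q t :
  tal_act q (mon_class tal_rel t) = mon_class tal_rel (tal_shift q t).
Proof. exact/mon_classP/tal_shift_eq/mon_repr_class. Qed.

Lemma tal_act0 q : tal_act q 0 = 0.
Proof. exact: tal_act_class. Qed.

Lemma tal_actD q : {morph tal_act q : x y / x + y}.
Proof.
move=> x y; rewrite -(mon_reprK x) -(mon_reprK y).
by rewrite -mon_classD !tal_act_class -mon_classD.
Qed.

(* The action of N[Z^k], whose elements are the finitely supported functions
   from Z^k to N. *)
Definition tal_gract (a : {fsfun 'rV[int]_k -> nat with 0%N})
    (x : talented_monoid) : talented_monoid :=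
  \sum_(q <- finsupp a) tal_act q x *+ a q.

Definition tal_le (x y : talented_monoid) := exists z, y = x + z.

Definition is_order_ideal (J : set talented_monoid) :=
  [/\ J 0,
      forall x y, J x -> J y -> J (x + y),
      forall x y, tal_le x y -> J y -> J x &
      forall q x, J x -> J (tal_act q x)].

Definition is_prime_order_ideal (P : set talented_monoid) :=
  [/\ is_order_ideal P, P != setT &
      forall J1 J2, is_order_ideal J1 -> is_order_ideal J2 ->
        J1 `&` J2 `<=` P -> J1 `<=` P \/ J2 `<=` P].

Definition is_filter (F : set talented_monoid) :=
  [/\ F !=set0,
      ~ F 0 /\ (forall q x, F x -> F (tal_act q x)),
      forall x y, F x -> tal_le x y -> F y &
      forall x y, F x -> F y ->
        exists a b z, [/\ F z, tal_le z (tal_gract a x) &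
                               tal_le z (tal_gract b y)]].

Definition is_prime_filter (F : set talented_monoid) :=
  is_filter F /\ (forall x y, F (x + y) -> F x \/ F y).

Record prime_order_ideal := PrimeOrderIdeal {
  poi_set :> set talented_monoid;
  poi_prop : is_prime_order_ideal poi_set }.

HB.instance Definition _ := gen_eqMixin prime_order_ideal.
HB.instance Definition _ := gen_choiceMixin prime_order_ideal.

Record prime_filter := PrimeFilter {
  pfil_set :> set talented_monoid;
  pfil_prop : is_prime_filter pfil_set }.

HB.instance Definition _ := gen_eqMixin prime_filter.
HB.instance Definition _ := gen_choiceMixin prime_filter.

Lemma order_idealT : is_order_ideal setT.
Proof. by []. Qed.

Lemma order_ideal_bigcap (I : Type) (D : set I) (J : I -> set talented_monoid) :
  (forall i, D i -> is_order_ideal (J i)) ->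
  is_order_ideal (\bigcap_(i in D) J i).
Proof.
move=> JI; split=> [i /JI[]//|x y Jx Jy i Di|x y xy Jy i Di|q x Jx i Di];
  have [J0 JD Jle Ja] := JI i Di.
- by apply: JD; [apply: Jx | apply: Jy].
- by apply: Jle xy _; apply: Jy.
- by apply: Ja; apply: Jx.
Qed.

Lemma order_idealI J1 J2 :
  is_order_ideal J1 -> is_order_ideal J2 -> is_order_ideal (J1 `&` J2).
Proof. by move=> I1 I2; rewrite -bigcap2E; apply: order_ideal_bigcap => -[|[|]]. Qed.

Lemma order_ideal_gract J a x :
  is_order_ideal J -> J x -> J (tal_gract a x).
Proof.
move=> [J0 JD _ Ja] Jx; apply: (big_ind J) => // q _.
by elim: (a q) => [|n IH]; rewrite ?mulr0n // mulrS; apply: JD => //; apply: Ja.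
Qed.

Definition poi_above (J : set talented_monoid) : set prime_order_ideal :=
  [set P : prime_order_ideal | J `<=` P].

Definition poi_open : set_system prime_order_ideal :=
  [set A | exists2 J, is_order_ideal J & ~` A = poi_above J].

Lemma poi_openT : poi_open setT.
Proof.
exists setT; first exact: order_idealT.
rewrite setCT; apply/seteqP; split=> // P.
by have [_ /eqP PT _] := poi_prop P; move=> TP; apply: PT; apply/seteqP; split.
Qed.

Lemma poi_openI : setI_closed poi_open.
Proof.
move=> A B [J JI AJ] [J' J'I BJ]; exists (J `&` J'); first exact: order_idealI.
rewrite setCI AJ BJ; apply/seteqP; split=> P.
  by case=> JP x []; [move=> /JP | move=> _ /JP].
by have [_ _ Pp] := poi_prop P; apply: Pp.
Qed.

Lemma poi_open_bigcup (Idx : Type) (f : Idx -> set prime_order_ideal) :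
  (forall i, poi_open (f i)) -> poi_open (\bigcup_i f i).
Proof.
move=> fo; rewrite /poi_open /= setC_bigcup.
exists (\bigcap_(J in [set J | is_order_ideal J /\
    forall i J', is_order_ideal J' -> ~` f i = poi_above J' -> J' `<=` J]) J).
  by apply: order_ideal_bigcap => J [].
apply/seteqP; split=> P.
  move=> fP x; apply; split; first by have [] := poi_prop P.
  by move=> i J' _ fJ; have := fP i I; rewrite fJ.
move=> JP i _; have [J JI fJ] := fo i; rewrite fJ => x Jx.
by apply: JP => J' [_ /(_ i J JI fJ)]; apply.
Qed.

HB.instance Definition _ := isOpenTopological.Build prime_order_ideal
  poi_openT poi_openI poi_open_bigcup.

Definition pfil_meets (J : set talented_monoid) : set prime_filter :=
  [set F : prime_filter | J `&` F !=set0].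

Lemma pfil_meets_cover :
  \bigcup_(J in is_order_ideal) pfil_meets J = setT.
Proof.
apply/seteqP; split=> // F _; exists setT; first exact: order_idealT.
by have [[[x Fx] _ _ _] _] := pfil_prop F; exists x.
Qed.

Lemma pfil_meets_join J1 J2 F :
  is_order_ideal J1 -> is_order_ideal J2 -> pfil_meets J1 F -> pfil_meets J2 F ->
  exists J, [/\ is_order_ideal J, pfil_meets J F &
                pfil_meets J `<=` pfil_meets J1 `&` pfil_meets J2].
Proof.
move=> I1 I2 [x [Jx Fx]] [y [Jy Fy]]; exists (J1 `&` J2); split.
- exact: order_idealI.
- have [[_ _ _ F3] _] := pfil_prop F.
  have [a [b [z [Fz zx zy]]]] := F3 _ _ Fx Fy.
  exists z; split=> //; split.
    by have [_ _ le1 _] := I1; apply: le1 zx _; apply: order_ideal_gract.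
  by have [_ _ le2 _] := I2; apply: le2 zy _; apply: order_ideal_gract.
- by move=> G [z [[J1z J2z] Gz]]; split; exists z.
Qed.

HB.instance Definition _ := isBaseTopological.Build prime_filter
  pfil_meets_cover pfil_meets_join.

End TalentedMonoid.

(* The associative, not necessarily unital, K-algebra presented by generators X
   and relations R: terms modulo the least congruence containing R and the
   laws of associative K-algebras. *)
Inductive alg_term (K X : Type) :=
| AlgGen of X
| AlgZero
| AlgAdd of alg_term K X & alg_term K X
| AlgScale of K & alg_term K X
| AlgMul of alg_term K X & alg_term K X.
Arguments AlgGen {K X}.
Arguments AlgZero {K X}.

HB.instance Definition _ (K X : Type) := gen_eqMixin (alg_term K X).
HB.instance Definition _ (K X : Type) := gen_choiceMixin (alg_term K X).

Definition alg_sum {K X : Type} (ts : seq (alg_term K X)) : alg_term K X :=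
  foldr (@AlgAdd K X) AlgZero ts.

Section PresentedAlgebra.
Context {K : fieldType} {X : Type} (R : alg_term K X -> alg_term K X -> Prop).

Local Notation "t ⊕ u" := (AlgAdd t u) (at level 50, left associativity).
Local Notation "a ⊙ t" := (AlgScale a t) (at level 40, left associativity).
Local Notation "t ⊗ u" := (AlgMul t u) (at level 40, left associativity).

Inductive alg_eq : alg_term K X -> alg_term K X -> Prop :=
| alg_rel t u : R t u -> alg_eq t u
| alg_refl t : alg_eq t t
| alg_sym t u : alg_eq t u -> alg_eq u t
| alg_trans t u w : alg_eq t u -> alg_eq u w -> alg_eq t w
| alg_add t t' u u' : alg_eq t t' -> alg_eq u u' -> alg_eq (t ⊕ u) (t' ⊕ u')
| alg_scale a t t' : alg_eq t t' -> alg_eq (a ⊙ t) (a ⊙ t')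
| alg_mul t t' u u' : alg_eq t t' -> alg_eq u u' -> alg_eq (t ⊗ u) (t' ⊗ u')
| alg_addA t u w : alg_eq (t ⊕ (u ⊕ w)) (t ⊕ u ⊕ w)
| alg_addC t u : alg_eq (t ⊕ u) (u ⊕ t)
| alg_add0 t : alg_eq (AlgZero ⊕ t) t
| alg_addN t : alg_eq (- 1 ⊙ t ⊕ t) AlgZero
| alg_scaleA a b t : alg_eq (a ⊙ (b ⊙ t)) ((a * b) ⊙ t)
| alg_scale1 t : alg_eq (1 ⊙ t) t
| alg_scaleDr a t u : alg_eq (a ⊙ (t ⊕ u)) (a ⊙ t ⊕ a ⊙ u)
| alg_scaleDl a b t : alg_eq ((a + b) ⊙ t) (a ⊙ t ⊕ b ⊙ t)
| alg_mulA t u w : alg_eq (t ⊗ (u ⊗ w)) (t ⊗ u ⊗ w)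
| alg_mulDl t u w : alg_eq ((t ⊕ u) ⊗ w) (t ⊗ w ⊕ u ⊗ w)
| alg_mulDr t u w : alg_eq (t ⊗ (u ⊕ w)) (t ⊗ u ⊕ t ⊗ w)
| alg_scaleAl a t u : alg_eq (a ⊙ (t ⊗ u)) (a ⊙ t ⊗ u)
| alg_scaleAr a t u : alg_eq (a ⊙ (t ⊗ u)) (t ⊗ (a ⊙ u)).

Definition alg_eqb t u := `[< alg_eq t u >].

Lemma alg_eqb_refl : reflexive alg_eqb.
Proof. by move=> t; apply/asboolP; apply: alg_refl. Qed.

Lemma alg_eqb_sym : symmetric alg_eqb.
Proof. by move=> t u; apply/asboolP/asboolP; apply: alg_sym. Qed.

Lemma alg_eqb_trans : transitive alg_eqb.
Proof.
by move=> t u w /asboolP ut /asboolP tw; apply/asboolP; apply: alg_trans tw.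
Qed.

Canonical alg_equiv := EquivRel alg_eqb alg_eqb_refl alg_eqb_sym alg_eqb_trans.

Definition presented_algebra := {eq_quot alg_equiv}.

HB.instance Definition _ := Choice.on presented_algebra.

Definition alg_class (t : alg_term K X) : presented_algebra :=
  \pi_({eq_quot alg_equiv}) t.

Definition alg_repr (x : presented_algebra) : alg_term K X :=
  repr (x : {eq_quot alg_equiv}).

Lemma alg_reprK : cancel alg_repr alg_class.
Proof. exact: reprK. Qed.

Lemma alg_classP t u : alg_class t = alg_class u <-> alg_eq t u.
Proof.
split=> [/eqP|tu]; first by rewrite /alg_class eqmodE => /asboolP.
by apply/eqP; rewrite /alg_class eqmodE; apply/asboolP.
Qed.

Lemma alg_repr_class t : alg_eq (alg_repr (alg_class t)) t.
Proof. by apply/alg_classP; rewrite alg_reprK. Qed.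

Definition palg_zero : presented_algebra := alg_class AlgZero.
Definition palg_add (x y : presented_algebra) : presented_algebra :=
  alg_class (alg_repr x ⊕ alg_repr y).
Definition palg_scale (a : K) (x : presented_algebra) : presented_algebra :=
  alg_class (a ⊙ alg_repr x).
Definition palg_opp (x : presented_algebra) := palg_scale (- 1) x.
Definition palg_mul (x y : presented_algebra) : presented_algebra :=
  alg_class (alg_repr x ⊗ alg_repr y).

Lemma palg_add_class t u :
  alg_class (t ⊕ u) = palg_add (alg_class t) (alg_class u).
Proof. by apply/alg_classP; apply: alg_add; apply/alg_sym/alg_repr_class. Qed.

Lemma palg_scale_class a t : alg_class (a ⊙ t) = palg_scale a (alg_class t).
Proof. by apply/alg_classP; apply: alg_scale; apply/alg_sym/alg_repr_class. Qed.

Lemma palg_mul_class t u :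
  alg_class (t ⊗ u) = palg_mul (alg_class t) (alg_class u).
Proof. by apply/alg_classP; apply: alg_mul; apply/alg_sym/alg_repr_class. Qed.

Let alg_classE := (palg_add_class, palg_scale_class, palg_mul_class).

Lemma palg_addA : associative palg_add.
Proof.
move=> x y z; rewrite -(alg_reprK x) -(alg_reprK y) -(alg_reprK z).
by rewrite -!alg_classE; apply/alg_classP/alg_addA.
Qed.

Lemma palg_addC : commutative palg_add.
Proof. by move=> x y; apply/alg_classP/alg_addC. Qed.

Lemma palg_add0 : left_id palg_zero palg_add.
Proof.
move=> x; rewrite -(alg_reprK x) /palg_zero -!alg_classE.
exact/alg_classP/alg_add0.
Qed.

Lemma palg_addN : left_inverse palg_zero palg_opp palg_add.
Proof.
move=> x; rewrite -(alg_reprK x) /palg_zero /palg_opp -!alg_classE.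
exact/alg_classP/alg_addN.
Qed.

HB.instance Definition _ :=
  GRing.isZmodule.Build presented_algebra palg_addA palg_addC palg_add0 palg_addN.

Lemma palg_scaleA a b x : palg_scale a (palg_scale b x) = palg_scale (a * b) x.
Proof.
rewrite -(alg_reprK x) -!alg_classE; exact/alg_classP/alg_scaleA.
Qed.

Lemma palg_scale1 : left_id 1 palg_scale.
Proof.
move=> x; rewrite -(alg_reprK x) -!alg_classE; exact/alg_classP/alg_scale1.
Qed.

Lemma palg_scaleDr : right_distributive palg_scale +%R.
Proof.
move=> a x y; rewrite -[+%R]/palg_add -(alg_reprK x) -(alg_reprK y).
rewrite -!alg_classE; exact/alg_classP/alg_scaleDr.
Qed.

Lemma palg_scaleDl x : {morph palg_scale^~ x : a b / a + b}.
Proof.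
move=> a b; rewrite -(alg_reprK x) -[RHS]/(palg_add _ _) -!alg_classE; exact/alg_classP/alg_scaleDl.
Qed.

HB.instance Definition _ := GRing.Zmodule_isLmodule.Build K presented_algebra
  palg_scaleA palg_scale1 palg_scaleDr palg_scaleDl.

Lemma alg_classD t u : alg_class (t ⊕ u) = alg_class t + alg_class u.
Proof. exact: palg_add_class. Qed.

Lemma alg_classZ a t : alg_class (a ⊙ t) = a *: alg_class t.
Proof. exact: palg_scale_class. Qed.

Lemma palg_mulA : associative palg_mul.
Proof.
move=> x y z; rewrite -(alg_reprK x) -(alg_reprK y) -(alg_reprK z).
by rewrite -!alg_classE; apply/alg_classP/alg_mulA.
Qed.

Lemma palg_mulDl : left_distributive palg_mul +%R.
Proof.
move=> x y z; rewrite -(alg_reprK x) -(alg_reprK y) -(alg_reprK z).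
by rewrite -alg_classD -!palg_mul_class -alg_classD; apply/alg_classP/alg_mulDl.
Qed.

Lemma palg_mulDr : right_distributive palg_mul +%R.
Proof.
move=> x y z; rewrite -(alg_reprK x) -(alg_reprK y) -(alg_reprK z).
by rewrite -alg_classD -!palg_mul_class -alg_classD; apply/alg_classP/alg_mulDr.
Qed.

Lemma palg_scaleAl a x y : a *: palg_mul x y = palg_mul (a *: x) y.
Proof.
rewrite -(alg_reprK x) -(alg_reprK y) -palg_mul_class -!alg_classZ -palg_mul_class.
exact/alg_classP/alg_scaleAl.
Qed.

Lemma palg_scaleAr a x y : a *: palg_mul x y = palg_mul x (a *: y).
Proof.
rewrite -(alg_reprK x) -(alg_reprK y) -palg_mul_class -!alg_classZ -palg_mul_class.
exact/alg_classP/alg_scaleAr.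
Qed.

End PresentedAlgebra.

(* The additive submonoid generated by A. *)
Definition finite_sums {V : nmodType} (A : set V) : set V :=
  [set x | exists m (y : 'I_m -> V),
    (forall i, A (y i)) /\ x = \sum_(i < m) y i].

Section FiniteSums.
Context {V : nmodType}.
Implicit Types A B : set V.

Lemma finite_sums0 A : finite_sums A 0.
Proof. by exists 0%N, (fun=> 0); rewrite big_ord0; split=> // -[]. Qed.

Lemma finite_sums_gen A x : A x -> finite_sums A x.
Proof. by exists 1%N, (fun=> x); rewrite big_ord1. Qed.

Lemma finite_sumsD A x y :
  finite_sums A x -> finite_sums A y -> finite_sums A (x + y).
Proof.
move=> [m [f [Af ->]]] [n [g [Ag ->]]].
exists (m + n)%N, (fun i => match fintype.split i with inl j => f j | inr j => g j end).
split=> [i|]; first by case: fintype.split.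
rewrite big_split_ord /=; congr (_ + _); apply: eq_bigr => i _.
  by rewrite (unsplitK (inl i)).
by rewrite (unsplitK (inr i)).
Qed.

Lemma finite_sums_sub A B : B 0 -> (forall x y, B x -> B y -> B (x + y)) ->
  A `<=` B -> finite_sums A `<=` B.
Proof.
by move=> B0 BD AB _ [m [f [Af ->]]]; apply: (big_ind B) => // i _; apply: AB.
Qed.

Lemma finite_sums_map A B (f : V -> V) :
  f 0 = 0 -> {morph f : x y / x + y} ->
  (forall x, A x -> finite_sums B (f x)) ->
  forall x, finite_sums A x -> finite_sums B (f x).
Proof.
move=> f0 fD AB; apply: finite_sums_sub => //=.
  by rewrite f0; apply: finite_sums0.
by move=> x y Bx By; rewrite fD; apply: finite_sumsD.
Qed.

End FiniteSums.

Section KumjianPask.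
Context (K : fieldType) {k : nat} (L : kgraph k).

Definition nonvertex_path := {l : path L | deg l != 0}.

Inductive kp_gen :=
| KPp of vertex L
| KPs of nonvertex_path
| KPsstar of nonvertex_path.

Local Notation term := (alg_term K kp_gen).
Local Notation p v := (AlgGen (KPp v) : term).
Local Notation s l := (AlgGen (KPs l) : term).
Local Notation sstar l := (AlgGen (KPsstar l) : term).
Local Notation "t ⊗ u" := (AlgMul t u) (at level 40, left associativity).

Inductive kp_rel : term -> term -> Prop :=
| KPpp u v : kp_rel (p u ⊗ p v) (if u == v then p u else AlgZero)
| KPss (l m n : nonvertex_path) :
    src (val l) = rng (val m) -> val n = comp (val l) (val m) ->
    kp_rel (s l ⊗ s m) (s n)
| KPsstarsstar (l m n : nonvertex_path) :
    src (val l) = rng (val m) -> val n = comp (val l) (val m) ->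
    kp_rel (sstar m ⊗ sstar l) (sstar n)
| KPps l : kp_rel (p (rng (val l)) ⊗ s l) (s l)
| KPsp l : kp_rel (s l ⊗ p (src (val l))) (s l)
| KPpsstar l : kp_rel (p (src (val l)) ⊗ sstar l) (sstar l)
| KPsstarp l : kp_rel (sstar l ⊗ p (rng (val l))) (sstar l)
| KPsstars (l m : nonvertex_path) : deg (val l) = deg (val m) ->
    kp_rel (sstar l ⊗ s m) (if l == m then p (src (val l)) else AlgZero)
| KPsum v (n : 'rV[nat]_k) (e : seq nonvertex_path) :
    n != 0 -> uniq e -> [set` map val e] = paths_from v n ->
    kp_rel (p v) (alg_sum [seq s l ⊗ sstar l | l <- e]).

Definition kumjian_pask := presented_algebra kp_rel.

HB.instance Definition _ := GRing.Lmodule.on kumjian_pask.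

Definition kp_mul : kumjian_pask -> kumjian_pask -> kumjian_pask :=
  @palg_mul K kp_gen kp_rel.

Definition kp_of_gen (g : kp_gen) : kumjian_pask :=
  alg_class kp_rel (AlgGen g).

Definition kp_gen_deg (g : kp_gen) : 'rV[int]_k :=
  match g with
  | KPp _ => 0
  | KPs l => zdeg (deg (val l))
  | KPsstar l => - zdeg (deg (val l))
  end.

(* The homogeneous components R_n of the grading: the smallest family of
   subspaces with R_m R_n contained in R_(m + n) that contains every generator
   in its degree. *)
Inductive kp_homog : 'rV[int]_k -> set kumjian_pask :=
| kp_homog_gen g : kp_homog (kp_gen_deg g) (kp_of_gen g)
| kp_homog0 n : kp_homog n 0
| kp_homogD n x y : kp_homog n x -> kp_homog n y -> kp_homog n (x + y)
| kp_homogZ n a x : kp_homog n x -> kp_homog n (a *: x)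
| kp_homogM m n x y :
    kp_homog m x -> kp_homog n y -> kp_homog (m + n) (kp_mul x y).

Definition is_ideal (I : set kumjian_pask) :=
  [/\ I 0,
      forall x y, I x -> I y -> I (x - y),
      forall x y, I y -> I (kp_mul x y) &
      forall x y, I x -> I (kp_mul x y)].

(* I is the sum of the subgroups I `&` R_n; this sum is automatically direct,
   since the sum of the R_n is. *)
Definition is_graded_ideal (I : set kumjian_pask) :=
  is_ideal I /\ I `<=` finite_sums (I `&` \bigcup_n kp_homog n).

Definition ideal_mul (I J : set kumjian_pask) : set kumjian_pask :=
  finite_sums [set kp_mul x y | x in I & y in J].

Definition is_graded_prime (P : set kumjian_pask) :=
  [/\ is_graded_ideal P, P != setT &
      forall I J, is_graded_ideal I -> is_graded_ideal J ->
        ideal_mul I J `<=` P -> I `<=` P \/ J `<=` P].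

Record graded_prime := GradedPrime {
  gp_set :> set kumjian_pask;
  gp_prop : is_graded_prime gp_set }.

HB.instance Definition _ := gen_eqMixin graded_prime.
HB.instance Definition _ := gen_choiceMixin graded_prime.

Lemma kp_mulDl x y z : kp_mul (x + y) z = kp_mul x z + kp_mul y z.
Proof. exact: palg_mulDl. Qed.

Lemma kp_mulDr x y z : kp_mul x (y + z) = kp_mul x y + kp_mul x z.
Proof. exact: palg_mulDr. Qed.

Lemma kp_mulA x y z : kp_mul x (kp_mul y z) = kp_mul (kp_mul x y) z.
Proof. exact: palg_mulA. Qed.

Lemma kp_mul0l x : kp_mul 0 x = 0.
Proof. by apply: (@addrI _ (kp_mul 0 x)); rewrite -kp_mulDl !addr0. Qed.

Lemma kp_mul0r x : kp_mul x 0 = 0.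
Proof. by apply: (@addrI _ (kp_mul x 0)); rewrite -kp_mulDr !addr0. Qed.

Lemma kp_mulNl x y : kp_mul (- x) y = - kp_mul x y.
Proof. by apply: (@addrI _ (kp_mul x y)); rewrite -kp_mulDl !subrr kp_mul0l. Qed.

Lemma kp_homog_sums (x : kumjian_pask) : finite_sums (\bigcup_n kp_homog n) x.
Proof.
rewrite -(alg_reprK x); elim: (alg_repr x) => [g||t IHt u IHu|a t IHt|t IHt u IHu].
- by apply: finite_sums_gen; exists (kp_gen_deg g) => //; apply: kp_homog_gen.
- exact: finite_sums0.
- by rewrite alg_classD; apply: finite_sumsD.
- rewrite alg_classZ; move: IHt; apply: (finite_sums_map (f := *:%R a)).
  + exact: scaler0.
  + exact: scalerDr.
  + move=> y [n _ yn]; apply: finite_sums_gen; exists n => //; exact: kp_homogZ.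
- rewrite [alg_class _ _]palg_mul_class; move: IHt.
  apply: (finite_sums_map (f := kp_mul^~ (alg_class kp_rel u))).
  + exact: kp_mul0l.
  + by move=> y z; apply: kp_mulDl.
  move=> y [m _ ym]; move: IHu; apply: (finite_sums_map (f := kp_mul y)).
  + exact: kp_mul0r.
  + exact: kp_mulDr.
  move=> z [n _ zn]; apply: finite_sums_gen; exists (m + n) => //.
  exact: kp_homogM.
Qed.

Lemma graded_idealT : is_graded_ideal setT.
Proof. by split=> // x _; rewrite setTI; apply: kp_homog_sums. Qed.

Lemma ideal_opp I x : is_ideal I -> I x -> I (- x).
Proof. by move=> [I0 IB _ _] Ix; rewrite -sub0r; apply: IB. Qed.

Lemma ideal_add I x y : is_ideal I -> I x -> I y -> I (x + y).
Proof.
move=> II Ix Iy; rewrite -[y]opprK; have [_ IB _ _] := II.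
by apply: IB => //; apply: ideal_opp.
Qed.

Lemma ideal_finite_sums (I A : set kumjian_pask) :
  is_ideal I -> A `<=` I -> finite_sums A `<=` I.
Proof.
move=> II AI; apply: finite_sums_sub => //; first by have [] := II.
by move=> *; apply: ideal_add.
Qed.

Lemma finite_sums_ideal (A : set kumjian_pask) :
  (forall x, A x -> A (- x)) ->
  (forall x y, A y -> A (kp_mul x y)) -> (forall x y, A x -> A (kp_mul x y)) ->
  is_ideal (finite_sums A).
Proof.
move=> AN Al Ar; split=> [|x y Ax Ay|x y|x y].
- exact: finite_sums0.
- apply: finite_sumsD => //; move: Ay; apply: (finite_sums_map (f := -%R)).
  + exact: oppr0.
  + exact: opprD.
  + by move=> z /AN; apply: finite_sums_gen.
- apply: (finite_sums_map (f := kp_mul x)).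
  + exact: kp_mul0r.
  + exact: kp_mulDr.
  + by move=> z /(Al x); apply: finite_sums_gen.
- apply: (finite_sums_map (f := kp_mul^~ y)).
  + exact: kp_mul0l.
  + by move=> u v; apply: kp_mulDl.
  + by move=> z /(Ar _ y); apply: finite_sums_gen.
Qed.

Lemma ideal_mul_sub_l I J : is_ideal I -> ideal_mul I J `<=` I.
Proof.
move=> II; apply: ideal_finite_sums => // _ [x Ix [y _ <-]].
by have [_ _ _ Ir] := II; apply: Ir.
Qed.

Lemma ideal_mul_sub_r I J : is_ideal J -> ideal_mul I J `<=` J.
Proof.
move=> JI; apply: ideal_finite_sums => // _ [x _ [y Jy <-]].
by have [_ _ Jl _] := JI; apply: Jl.
Qed.

Lemma graded_ideal_mul I J :
  is_graded_ideal I -> is_graded_ideal J -> is_graded_ideal (ideal_mul I J).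
Proof.
move=> [II Ig] [JI Jg].
have IJ : is_ideal (ideal_mul I J).
  apply: finite_sums_ideal => [_ [x Ix [y Jy <-]]|z _ [x Ix [y Jy <-]]|_ z [x Ix [y Jy <-]]].
  - exists (- x); first exact: ideal_opp.
    by exists y => //; apply: kp_mulNl.
  - exists (kp_mul z x); first by have [_ _ Il _] := II; apply: Il.
    by exists y => //; rewrite kp_mulA.
  - exists x => //; exists (kp_mul y z); last by rewrite kp_mulA.
    by have [_ _ _ Jr] := JI; apply: Jr.
split=> //; apply: finite_sums_sub.
- exact: finite_sums0.
- by move=> *; apply: finite_sumsD.
move=> _ [x /Ig Ix [y /Jg Jy <-]]; move: Ix.
apply: (finite_sums_map (f := kp_mul^~ y)).
- exact: kp_mul0l.
- by move=> u v; apply: kp_mulDl.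
move=> u [Iu [m _ um]]; move: Jy; apply: (finite_sums_map (f := kp_mul u)).
- exact: kp_mul0r.
- exact: kp_mulDr.
move=> v [Jv [n _ vn]]; apply: finite_sums_gen; split.
  by apply: finite_sums_gen; exists u => //; exists v.
by exists (m + n) => //; apply: kp_homogM.
Qed.

Lemma graded_ideal_sum (D : set (set kumjian_pask)) :
  D `<=` is_graded_ideal -> is_graded_ideal (finite_sums (\bigcup_(I in D) I)).
Proof.
move=> DI; split.
  apply: finite_sums_ideal => [x [I IDI Ix]|x y [I IDI Iy]|x y [I IDI Ix]];
    exists I => //; have [II _] := DI _ IDI.
  - exact: ideal_opp.
  - by have [_ _ Il _] := II; apply: Il.
  - by have [_ _ _ Ir] := II; apply: Ir.
apply: finite_sums_sub.
- exact: finite_sums0.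
- by move=> *; apply: finite_sumsD.
move=> x [I IDI Ix]; have [_ /(_ x Ix)] := DI _ IDI.
apply: (finite_sums_map (f := id)) => // y [Iy hy].
by apply: finite_sums_gen; split=> //; apply: finite_sums_gen; exists I.
Qed.

Definition gp_above (I : set kumjian_pask) : set graded_prime :=
  [set P : graded_prime | I `<=` P].

Definition gp_open : set_system graded_prime :=
  [set A | exists2 I, is_graded_ideal I & ~` A = gp_above I].

Lemma gp_openT : gp_open setT.
Proof.
exists setT; first exact: graded_idealT.
rewrite setCT; apply/seteqP; split=> // P.
by have [_ /eqP PT _] := gp_prop P; move=> TP; apply: PT; apply/seteqP; split.
Qed.

Lemma gp_openI : setI_closed gp_open.
Proof.
move=> A B [I Ig AI] [J Jg BJ]; exists (ideal_mul I J).
  exact: graded_ideal_mul.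
rewrite setCI AI BJ; apply/seteqP; split=> P.
  case=> sP; apply: (subset_trans _ sP).
    by apply: ideal_mul_sub_l; have [] := Ig.
  by apply: ideal_mul_sub_r; have [] := Jg.
by have [_ _ Pp] := gp_prop P; apply: Pp.
Qed.

Lemma gp_open_bigcup (Idx : Type) (f : Idx -> set graded_prime) :
  (forall i, gp_open (f i)) -> gp_open (\bigcup_i f i).
Proof.
move=> fo; rewrite /gp_open /= setC_bigcup.
exists (finite_sums (\bigcup_(I in [set I | is_graded_ideal I /\
    exists i, ~` f i = gp_above I]) I)).
  by apply: graded_ideal_sum => I [].
apply/seteqP; split=> P.
  have [[PI _] _ _] := gp_prop P => fP.
  apply: ideal_finite_sums => // x [I [_ [i fI]] Ix].
  by have := fP i Logic.I; rewrite fI; apply.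
move=> IP i _; have [I Ig fI] := fo i; rewrite fI => x Ix.
by apply/IP/finite_sums_gen; exists I => //; split=> //; exists i.
Qed.

HB.instance Definition _ := isOpenTopological.Build graded_prime
  gp_openT gp_openI gp_open_bigcup.

End KumjianPask.

Definition homeomorphic (S T : topologicalType) :=
  exists (f : S -> T) (g : T -> S),
    [/\ cancel f g, cancel g f, continuous f & continuous g].

Section Spectral.
Context (T : topologicalType).

Definition irreducible_set (C : set T) :=
  C !=set0 /\ forall A B, closed A -> closed B ->
    C `<=` A `|` B -> C `<=` A \/ C `<=` B.

Definition spectral_space :=
  [/\ cover_compact [set: T],
      exists B : set_system T,
        [/\ basis B, B `<=` @cover_compact T & setI_closed B],
      kolmogorov_space T &
      forall C : set T, closed C -> irreducible_set C ->
        exists x, closure [set x] = C].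

End Spectral.

(* Main.v *)
(* Every order ideal of T_Lambda, and every graded ideal of KP(Lambda), is
   determined by the set H of the vertices it contains, and the sets H that occur
   are exactly the hereditary saturated ones. In both cases an ideal is prime if
   and only if the complement of H is a maximal tail, and the prime filters are
   the complements of the prime order ideals. So each of the four spaces is a copy
   of the set of maximal tails, and in each of them the open sets are the sets of
   all points whose tail meets A, for a set A of vertices. If there are finitely
   many vertices then the space is finite, and the union of the tails in an
   irreducible closed set is the tail of its generic point.

   A graded ideal I is determined by its vertices because a homogeneous x in I is
   a combination of elements s_l s_m^* with all l of one degree and all m of one
   degree; then s_l^* x s_m is a multiple of p_(s(l)) by the coefficient of
   s_l s_m^*. Conversely, the ideal generated by a hereditary saturated H contains
   no p_v with v outside H, because KP(Lambda) acts on the functions on paths, two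
   functions being identified if they agree on all long enough paths with source
   outside H: this action kills p_w for w in H but not p_v. *)

Require Import Defs.
From mathcomp Require Import all_boot all_order all_algebra.
From mathcomp Require Import finmap.
From mathcomp Require Import all_classical topology.

Set Implicit Arguments.
Unset Strict Implicit.
Unset Printing Implicit Defensive.

Import Defs GRing.Theory.

Local Open Scope classical_set_scope.
Local Open Scope ring_scope.

(** * Arithmetic of degrees *)

Lemma rVnat_addI k : right_injective (@GRing.add 'rV[nat]_k).
Proof.
move=> m n n' /matrixP mn; apply/matrixP => i j.
by have := mn i j; rewrite !mxE; apply: addnI.
Qed.

(** Induction on the sum of the entries. It carries (MT2), stated for the generators [delta_mx 0 i],
    to every degree. *)
Lemma rVnat_ind k (P : 'rV[nat]_k -> Prop) :
  P 0 -> (forall i n, P n -> P (delta_mx 0 i + n)) -> forall n, P n.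
Proof.
move=> P0 PD n; have [m nm] : exists m, (\sum_i n ord0 i <= m)%N.
  by exists (\sum_i n ord0 i)%N.
elim: m n nm => [|m IH] n nm.
  suff -> : n = 0 by [].
  apply/rowP => i; rewrite !mxE; move: nm; rewrite leqn0 sum_nat_eq0.
  by move=> /forallP/(_ i)/eqP.
have [/eqP n0|] := boolP [forall i, n ord0 i == 0%N].
  suff -> : n = 0 by [].
  by move/eqP/forallP: n0 => n0; apply/rowP => i; rewrite !mxE (eqP (n0 i)).
rewrite negb_forall => /existsP [i ni].
pose n' : 'rV[nat]_k := \row_j (n ord0 j - (j == i))%N.
have -> : n = delta_mx 0 i + n'.
  apply/rowP => j; rewrite !mxE eqxx /=; have [->|_] := eqVneq j i.
    by rewrite -[RHS]/(1 + (n ord0 i - 1))%N subnKC // lt0n.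
  by rewrite /= subn0 -[RHS]/(0 + n ord0 j)%N.
apply: PD; apply: IH; rewrite -ltnS; apply: leq_trans nm.
rewrite (bigD1 i) //= [leqRHS](bigD1 i) //= !mxE eqxx -addSn leq_add //.
  by rewrite subn1 prednK // lt0n.
by apply: leq_sum => j /negPf ji; rewrite mxE ji subn0.
Qed.

(** * Hereditary saturated sets and maximal tails *)

Section Factorization.
Context {k : nat} (L : kgraph k).
Implicit Types (v w : vertex L) (l a b : path L) (m n : 'rV[nat]_k).

Lemma path_factor l m n : deg l = m + n ->
  exists a b, [/\ src a = rng b, deg a = m, deg b = n & l = comp a b].
Proof. by move=> /unique_factorization [[a b] [[]]]; exists a, b. Qed.

(** Cancelling [deg a] shows that both pairs factor the same path in the same degrees, so unique
    factorization identifies them. *)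
Lemma comp_inj a b a' b' : src a = rng b -> src a' = rng b' ->
  deg a = deg a' -> comp a b = comp a' b' -> a = a' /\ b = b'.
Proof.
move=> ab ab' da e; have d := deg_comp ab.
have [x [_ u]] := unique_factorization d.
have x1 : x = (a, b) by apply: u.
have x2 : x = (a', b').
  apply: u; split => //=; apply: (@rVnat_addI _ (deg a')).
  by rewrite -deg_comp // -e d da.
by move: x2; rewrite x1 => -[].
Qed.

(** Composing [l] with the identity on either side gives two factorizations of [l] in degrees 0 and
    0. *)
Lemma deg0_ident l : deg l = 0 -> l = ident (rng l).
Proof.
move=> dl; have e : comp (ident (rng l)) l = comp l (ident (src l)).
  by rewrite comp_identl comp_identr.
have [] // := comp_inj _ _ _ e; rewrite ?src_ident ?rng_ident //.
by rewrite deg_ident.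
Qed.

Lemma paths_from_comp v m n a b : paths_from v m a -> paths_from (src a) n b ->
  paths_from v (m + n) (comp a b).
Proof. by move=> [da ra] [db /esym ab]; split; rewrite ?deg_comp ?rng_comp ?da ?db. Qed.

Lemma paths_from_factor v m n l : paths_from v (m + n) l ->
  exists a b, [/\ paths_from v m a, paths_from (src a) n b, src b = src l &
    l = comp a b].
Proof.
move=> [dl rl]; have [a [b [ab da db e]]] := path_factor dl.
by exists a, b; split; [split| |rewrite e src_comp|]; rewrite // -rl e rng_comp.
Qed.

End Factorization.

Section HereditarySaturated.
Context {k : nat} {L : kgraph k}.
Implicit Types (v w : vertex L) (l a b : path L) (m n : 'rV[nat]_k).
Implicit Types (A H M : set (vertex L)).

Definition hereditary_saturated H :=
  (forall l, H (rng l) -> H (src l)) /\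
  (forall v n, (forall l, paths_from v n l -> H (src l)) -> H v).

Lemma unsaturated_path H v n : hereditary_saturated H -> ~ H v ->
  exists2 l, paths_from v n l & ~ H (src l).
Proof.
move=> [_ s]; apply: contra_notP => h; apply: (s v n) => l vl.
by apply: contrapT => Hl; apply: h; exists l.
Qed.

(** Heredity of the complement is the contrapositive of (MT1). Iterating (MT2) along a path gives
    saturation in every degree; saturation in degree [delta_mx 0 i] gives (MT2) back. *)
Lemma maximal_tailP M : is_maximal_tail M <->
  [/\ hereditary_saturated (~` M), M !=set0 &
      forall u v, M u -> M v -> exists a b,
        [/\ rng a = u, rng b = v, src a = src b & M (src a)]].
Proof.
split=> [[M0 MT1 MT2 MT3]|[hs M0 MT3]]; split=> //.
- split=> [l nMl Ml|v n]; first by apply: nMl; apply: MT1 Ml _; exists l.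
  move=> nM Mv.
  suff [l /nM] : exists2 l, paths_from v n l & M (src l) by [].
  elim/rVnat_ind: n v {nM} Mv => [|i n IH] v Mv.
    by exists (ident v); rewrite ?src_ident //; split; rewrite ?deg_ident ?rng_ident.
  have [a va /IH [b ab Mb]] := MT2 v i Mv.
  exists (comp a b); first exact: paths_from_comp va ab.
  by case: ab => _ ab; rewrite src_comp.
- move=> u v Mu Mv; have [w [Mw [a [au aw]] [b [bv bw]]]] := MT3 u v Mu Mv.
  by exists a, b; rewrite aw bw.
- move=> v w Mw [l [lv lw]]; apply: contrapT => Mv; case: hs => h _.
  by apply: (h l); rewrite ?lv ?lw.
- move=> v i Mv; have [|l vl /contrapT Ml] := unsaturated_path (delta_mx 0 i) hs (v := v).
    by apply.
  by exists l.
- move=> u v Mu Mv; have [a [b [au bv ab Ma]]] := MT3 u v Mu Mv.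
  by exists (src a); split; [|exists a|exists b].
Qed.

(** For row-finite [L], the least hereditary saturated set containing [A]: one saturation step, in a
    degree of free choice, applied to the vertices reachable from [A]. *)
Definition hs_closure A : set (vertex L) :=
  [set y | exists n, forall a, paths_from y n a ->
    exists2 l, A (rng l) & src l = src a].

Lemma sub_hs_closure A : A `<=` hs_closure A.
Proof.
move=> v Av; exists 0 => a [/deg0_ident aE av]; exists (ident v).
  by rewrite rng_ident.
by rewrite aE src_ident av src_ident.
Qed.

Lemma hs_closure_sub A H : hereditary_saturated H -> A `<=` H ->
  hs_closure A `<=` H.
Proof.
move=> [h s] AH v [n vn]; apply: (s v n) => a /vn [l /AH/h + <-].
exact.
Qed.

Hypothesis hfin : row_finite L.

Lemma paths_from_enum v n : exists2 e : seq (path L),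
  uniq e & [set` e] = paths_from v n.
Proof.
by exists (fset_set (paths_from v n)); rewrite ?fset_uniq // fset_setK //.
Qed.

(** The degree that works for [rng l] also works for [src l]. For saturation, row-finiteness leaves
    finitely many paths of degree [n], and the sum of the degrees [N l] bounds each of them. *)
Lemma hs_closureP A : hereditary_saturated (hs_closure A).
Proof.
split=> [l [n hn]|v n h].
  exists n => c lc.
  (* The path [comp l c] is cut again, now after an initial segment of degree [n]. That segment ends
     at a vertex reachable from [A], hence so does the whole path. *)
  have dlc : paths_from (rng l) (n + deg l) (comp l c).
    by rewrite addrC; apply: paths_from_comp lc.
  have [a [b [la ab b_src _]]] := paths_from_factor dlc.
  have [x Ax xa] := hn a la; have xb : src x = rng b by rewrite xa; case: ab.
  exists (comp x b); first by rewrite rng_comp.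
  by rewrite src_comp // b_src src_comp //; case: lc.
have [e ue eE] := paths_from_enum v n.
have /choice [N hN] : forall l, exists N : 'rV[nat]_k, paths_from v n l ->
    forall a, paths_from (src l) N a -> exists2 x, A (rng x) & src x = src a.
  move=> l; have [/h [N hN]|] := pselect (paths_from v n l); first by exists N.
  by exists 0.
exists (n + \sum_(l <- e) N l) => c vc.
have [a [b [va ab bc _]]] := paths_from_factor vc.
have ae : a \in e by have : [set` e] a by rewrite eE.
move: ab; rewrite (big_rem a) //= => /paths_from_factor [a' [b' [aa' [_ ab'] b'b _]]].
have [x Ax xa'] := hN a va a' aa'; exists (comp x b').
  by rewrite rng_comp // ab'.
by rewrite src_comp ?ab' // b'b.
Qed.

(* For the forward direction, the closures of [u] and of [v] intersect outside
   [H]; from a vertex there, a long enough path that stays outside [H] ends at a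
   vertex reached both from [u] and from [v]. *)
Lemma prime_hereditary_saturatedP H : hereditary_saturated H ->
  (H != setT /\ forall H1 H2, hereditary_saturated H1 ->
     hereditary_saturated H2 -> H1 `&` H2 `<=` H -> H1 `<=` H \/ H2 `<=` H) <->
  is_maximal_tail (~` H).
Proof.
move=> Hhs; rewrite maximal_tailP setCK; split=> [[HT Hp]|[_ [x Hx] MT3]].
  split=> //.
    by apply/set0P; apply: contra HT => /eqP H0; rewrite -(setCK H) H0 setC0.
  move=> u v Hu Hv; apply: contrapT => no.
  case: (Hp _ _ (hs_closureP [set u]) (hs_closureP [set v])).
  - move=> y [[m ym] [n yn]]; apply: contrapT => Hy.
    have [l yl Hl] := unsaturated_path (m + n) Hhs Hy; apply: no.
    have [a [b [/ym [x xu xa] ab bl lE]]] := paths_from_factor yl.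
    move: yl; rewrite addrC => /paths_from_factor
      [a' [b' [/yn [x' xv xa'] ab' bl' lE']]].
    have [xb xb'] : src x = rng b /\ src x' = rng b'.
      by rewrite xa xa'; case: ab; case: ab'.
    exists (comp x b), (comp x' b').
    by split; rewrite ?rng_comp ?src_comp ?bl ?bl'.
  - by move/(_ u (sub_hs_closure (erefl u))).
  - by move/(_ v (sub_hs_closure (erefl v))).
split; first by apply/eqP => HT; rewrite HT in Hx; apply: Hx.
(* Conversely, for [u] in [H1] and [v] in [H2], both outside [H], the common vertex given by (MT3)
   lies in [H1] and [H2] by heredity but not in [H]. *)
move=> H1 H2 [h1 _] [h2 _] H12; apply: contrapT.
move=> /not_orP [/existsNP [u /not_implyP [H1u Hu]]].
move=> /existsNP [v /not_implyP [H2v Hv]].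
have [a [b [au bv ab]]] := MT3 u v Hu Hv; apply; apply: H12; split.
  by apply: h1; rewrite au.
by rewrite ab; apply: h2; rewrite bv.
Qed.

End HereditarySaturated.

(** * The topology of the space of maximal tails *)

(** These conditions determine [T] up to homeomorphism, so it is enough to check them once for each
    of the four spaces. *)
Definition tail_model {k} (L : kgraph k) (T : topologicalType)
    (tail : T -> set (vertex L)) :=
  [/\ injective tail,
      forall M, is_maximal_tail M <-> exists t, tail t = M &
      forall U : set T, open U <->
        exists A, U = [set t | tail t `&` A !=set0]].

Section TailModel.
Context {k : nat} {L : kgraph k}.

Lemma tail_model_homeomorphic (S T : topologicalType)
    (tailS : S -> set (vertex L)) (tailT : T -> set (vertex L)) :
  tail_model tailS -> tail_model tailT -> homeomorphic S T.
Proof.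
move=> [injS imS openS] [injT imT openT].
have /choice [f fE] : forall s, exists t, tailT t = tailS s.
  by move=> s; apply/imT/imS; exists s.
have /choice [g gE] : forall t, exists s, tailS s = tailT t.
  by move=> t; apply/imS/imT; exists t.
exists f, g; split.
- by move=> s; apply: injS; rewrite gE fE.
- by move=> t; apply: injT; rewrite fE gE.
- apply/continuousP => U /openT [A ->]; apply/openS; exists A.
  by apply/seteqP; split=> s /=; rewrite fE.
- apply/continuousP => U /openS [A ->]; apply/openT; exists A.
  by apply/seteqP; split=> s /=; rewrite gE.
Qed.

Variables (T : topologicalType) (tail : T -> set (vertex L)).
Hypothesis modelT : tail_model tail.

Lemma tail_model_closed (C : set T) :
  closed C <-> exists A, C = [set t | tail t `&` A = set0].
Proof.
have [_ _ openT] := modelT; rewrite -openC openT.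
have meetsC A : ~` [set t | tail t `&` A !=set0] = [set t | tail t `&` A = set0].
  by apply/seteqP; split=> t /=; rewrite nonemptyPn.
by split=> -[A CA]; exists A; rewrite -?meetsC -?CA ?setCK // CA -meetsC setCK.
Qed.

(** A closed set consists of the points whose tail misses some [A], so it is a down-set for
    inclusion of tails; taking for [A] the complement of [tail t] gives the smallest one containing
    [t]. *)
Lemma tail_model_closure t : closure [set t] = [set s | tail s `<=` tail t].
Proof.
apply/seteqP; split=> s.
  rewrite closureE => /(_ [set r | tail r `<=` tail t]) /=; apply.
  split; last by move=> r ->.
  apply/tail_model_closed; exists (~` tail t).
  by apply/seteqP; split=> r /=; rewrite -subsets_disjoint.
move=> /= st; rewrite closureE => C [/tail_model_closed [A ->] /(_ t erefl) /= tA].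
by apply/seteqP; split=> // v [/st tv Av]; rewrite -tA.
Qed.

(** The generic point has the union of the tails in [C] as its tail. (MT1) and (MT2) pass to unions;
    (MT3) is where irreducibility enters. *)
Lemma tail_model_sober (C : set T) : closed C -> irreducible_set C ->
  exists t, closure [set t] = C.
Proof.
have [injT imT _] := modelT => clC [[t0 Ct0] irrC].
have tailP t : is_maximal_tail (tail t) by apply/imT; exists t.
have [t tE] : exists t, tail t = \bigcup_(s in C) tail s.
  apply/imT; split.
  - by have [[v tv] _ _ _] := tailP t0; exists v, t0.
  - move=> v w [s Cs sw] vw; exists s => //.
    by have [_ MT1 _ _] := tailP s; apply: MT1 sw vw.
  - move=> v i [s Cs sv]; have [_ _ MT2 _] := tailP s.
    by have [l vl sl] := MT2 v i sv; exists l => //; exists s.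
  - move=> u v [s Cs su] [r Cr rv].
    have cl w : closed [set x | ~ tail x w].
      apply/tail_model_closed; exists [set w]; apply/seteqP; split=> x /=.
        by move=> xw; apply/seteqP; split=> // y [+ yw]; rewrite yw.
      by move=> + xw => /seteqP[/(_ w)]; case.
    (* If [u] and [v] had no common [w] in the union, no tail in [C] would contain both, and the
       closed sets of points avoiding [u] and avoiding [v] would cover [C]. *)
    apply: contrapT => no.
    case: (irrC _ _ (cl u) (cl v)); last 2 first.
    + by move/(_ s Cs).
    + by move/(_ r Cr).
    move=> x Cx; apply: contrapT => /not_orP [/contrapT xu /contrapT xv].
    have [_ _ _ MT3] := tailP x; have [w [xw uw vw]] := MT3 u v xu xv.
    by apply: no; exists w; split=> //; exists x.
exists t; rewrite tail_model_closure tE.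
apply/seteqP; split=> s; last by move=> Cs v sv; exists s.
(* Every tail in [C] misses [A], so their union does, and so does any tail contained in the
   union. *)
move: clC => /tail_model_closed [A CA] /= sC; rewrite CA /=.
apply/seteqP; split=> // v [/sC [r + rv] Av]; rewrite CA /= => rA.
by have : (tail r `&` A) v by []; rewrite rA.
Qed.

Lemma tail_model_T0 : kolmogorov_space T.
Proof.
have [injT imT openT] := modelT => x y xy.
have sep a b : ~ tail a `<=` tail b ->
    exists A : set T, A \in nbhs a /\ b \in ~` A.
  move=> /existsNP [v /not_implyP [av bv]].
  exists [set t | tail t `&` [set v] !=set0]; split; rewrite inE.
    apply: open_nbhs_nbhs; split; first by apply/openT; exists [set v].
    by exists v.
  by move=> [w [bw wv]]; apply: bv; rewrite -wv.
have [xley|/sep [A xA]] := pselect (tail x `<=` tail y); last by exists A; left.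
have [ylex|/sep [A yA]] := pselect (tail y `<=` tail x); last by exists A; right.
by move/eqP: xy; case; apply: injT; apply/seteqP.
Qed.

(** Since [tail] is injective, [T] is finite. Hence all its subsets are compact and the family of
    all open sets is a suitable base. *)
Lemma tail_model_spectral : finite_set [set: vertex L] -> spectral_space T.
Proof.
move=> finL; have [injT _ _] := modelT.
have /finite_seqP [e eE] := finL.
have finT (A : set T) : finite_set A.
  apply: sub_finite_set (@subsetT _ A) _.
  pose f (t : T) := [tuple of [seq `[< tail t v >] | v <- in_tuple e]].
  rewrite -(preimage_setT f); apply: finite_preimage => // s t _ _ fst.
  apply: injT; apply/seteqP.
  suff h v : `[< tail s v >] = `[< tail t v >].
    by split=> v /asboolP; [rewrite h|rewrite -h] => /asboolP.
  have : v \in e by have : [set` e] v by rewrite -eE.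
  by move: v; apply/eq_in_map; have /(congr1 val) := fst.
have cpt (A : set T) : cover_compact A.
  move=> I D f _; have /finite_seqP [r ->] := finT A.
  elim: r => [|x r IH] cov; first by exists fset0.
  have [|X XD rX] := IH; first by move=> y yr; apply: cov; rewrite /= inE yr orbT.
  have [i Di fx] := cov x (mem_head x r); exists (i |` X)%fset.
    by move=> j; rewrite !inE => /predU1P [->|/XD]; rewrite ?inE.
  move=> y /=; rewrite inE => /predU1P [->|/rX [j Xj fjy]].
    by exists i => //=; rewrite !inE eqxx.
  by exists j => //=; rewrite !inE Xj orbT.
split=> //.
- exists open; split=> //; last by move=> A B; apply: openI.
  split=> // x A; rewrite nbhsE => -[B [oB Bx] BA]; exists B => //.
- exact: tail_model_T0.
- exact: tail_model_sober.
Qed.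

End TailModel.

Section TailSpace.
Context {k : nat} (L : kgraph k).

Lemma tail_set_inj : injective (@tail_set k L).
Proof.
by move=> [M Mt] [N Nt] /= MN; subst N; rewrite (Prop_irrelevance Mt Nt).
Qed.

(** A tail lies below the union of [S] iff it misses the complement of that union. Conversely, given
    [A], one takes for [S] all tails missing [A]. *)
Lemma maximal_tail_model : tail_model (@tail_set k L).
Proof.
split=> [|M|U]; first exact: tail_set_inj.
  by split=> [Mt|[t <-]]; [exists (MaximalTail Mt)|apply: tail_prop].
split=> [[S US]|[A ->]].
  exists (~` \bigcup_(N in S) (N : set (vertex L))).
  rewrite -(setCK U) US; apply/seteqP.
  by split=> M /=; rewrite /tails_below /= subsets_disjoint -nonemptyPn ?notK.
exists [set M | tail_set M `&` A = set0]; apply/seteqP; split=> M /=.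
  by move=> /nonemptyPn MA v Mv; exists M.
move=> MS /= [v [/MS [N NA Nv] Av]].
by have : (tail_set N `&` A) v by []; rewrite NA.
Qed.

End TailSpace.

(** * Prime ideals and maximal tails *)

Section IdealSystem.
Context {k : nat} {L : kgraph k}.

(* Both the order ideals of the talented monoid and the graded ideals of the
   Kumjian-Pask algebra form such a system; [mul] stands for the intersection
   and for the product of ideals, respectively. *)
Record ideal_system (X : Type) (ideal : set (set X)) (gen : vertex L -> X)
    (mul : set X -> set X -> set X) := IdealSystem {
  ideal_setT : ideal setT;
  ideal_trace_hs : forall J, ideal J -> hereditary_saturated (gen @^-1` J);
  ideal_trace_sub : forall J1 J2, ideal J1 -> ideal J2 ->
    gen @^-1` J1 `<=` gen @^-1` J2 -> J1 `<=` J2;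
  ideal_of_trace : forall H, hereditary_saturated H ->
    exists2 J, ideal J & gen @^-1` J = H;
  ideal_mul_ideal : forall J1 J2, ideal J1 -> ideal J2 -> ideal (mul J1 J2);
  ideal_mul_trace : forall J1 J2, ideal J1 -> ideal J2 ->
    gen @^-1` mul J1 J2 = gen @^-1` J1 `&` gen @^-1` J2 }.

Variables (X : Type) (ideal : set (set X)) (gen : vertex L -> X).
Variable mul : set X -> set X -> set X.
Hypotheses (sysX : ideal_system ideal gen mul) (hfin : row_finite L).

Lemma ideal_sub_trace J1 J2 : ideal J1 -> ideal J2 ->
  J1 `<=` J2 <-> gen @^-1` J1 `<=` gen @^-1` J2.
Proof.
by move=> I1 I2; split=> [J12 v|]; [apply: J12|apply: (ideal_trace_sub sysX)].
Qed.

Lemma ideal_trace_inj J1 J2 : ideal J1 -> ideal J2 ->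
  gen @^-1` J1 = gen @^-1` J2 -> J1 = J2.
Proof.
by move=> I1 I2 J12; apply/seteqP; split; apply/ideal_sub_trace; rewrite // J12.
Qed.

Definition prime_ideal P := [/\ ideal P, P != setT &
  forall J1 J2, ideal J1 -> ideal J2 -> mul J1 J2 `<=` P ->
    J1 `<=` P \/ J2 `<=` P].

(** Passing to traces preserves and reflects inclusion and turns [mul] into intersection, so
    primeness becomes the condition of [prime_hereditary_saturatedP]. *)
Lemma prime_idealP P : ideal P ->
  prime_ideal P <-> is_maximal_tail (~` (gen @^-1` P)).
Proof.
move=> IP; rewrite -(prime_hereditary_saturatedP hfin) //; last first.
  exact: (ideal_trace_hs sysX).
have PT : P != setT <-> gen @^-1` P != setT.
  split; apply: contra => /eqP; last by move=> ->.
  by rewrite -(preimage_setT gen) => /(ideal_trace_inj IP (ideal_setT sysX))/eqP.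
split=> [[_ /PT P1 Pp]|[/PT P1 Pp]]; split=> //.
  move=> H1 H2 /(ideal_of_trace sysX) [J1 I1 <-] /(ideal_of_trace sysX) [J2 I2 <-].
  rewrite -(ideal_mul_trace sysX) // -!ideal_sub_trace //.
    exact: Pp.
  exact: (ideal_mul_ideal sysX).
move=> J1 J2 I1 I2; rewrite !ideal_sub_trace //; last exact: (ideal_mul_ideal sysX).
rewrite (ideal_mul_trace sysX) //; apply: Pp; exact: (ideal_trace_hs sysX).
Qed.

Lemma ideal_system_tail_model (T : topologicalType) (carrier : T -> set X) :
  injective carrier ->
  (forall P, prime_ideal P <-> exists t, carrier t = P) ->
  (forall U : set T, open U <->
     exists2 J, ideal J & ~` U = [set t | J `<=` carrier t]) ->
  tail_model (fun t => ~` (gen @^-1` carrier t)).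
Proof.
move=> cinj cim copen.
have cP t : prime_ideal (carrier t) by apply/cim; exists t.
have cI t : ideal (carrier t) by have [] := cP t.
split=> [s t /setC_inj/ideal_trace_inj st|M|U].
- by apply: cinj; apply: st.
- split=> [|[t <-]]; last by apply/prime_idealP.
  move=> Mt; have [Mhs _ _] := (maximal_tailP M).1 Mt.
  have [J IJ JM] := ideal_of_trace sysX Mhs.
  have /cim [t tJ] : prime_ideal J by apply/prime_idealP; rewrite // JM setCK.
  by exists t; rewrite tJ JM setCK.
rewrite copen; split=> [[J IJ UJ]|[A UA]].
  exists (gen @^-1` J); rewrite -(setCK U) UJ.
  apply/seteqP; split=> t /=; rewrite ideal_sub_trace // => h.
    by apply: contrapT => /nonemptyPn; rewrite setIC -subsets_disjoint.
  by move=> /subsets_disjoint; rewrite setIC => /nonemptyPn.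
(* A trace is hereditary and saturated, so it contains [A] iff it contains the closure of [A], which
   is itself the trace of an ideal. *)
have [J IJ JA] := ideal_of_trace sysX (hs_closureP hfin A).
exists J => //; rewrite UA; apply/seteqP.
split=> t /=; rewrite ideal_sub_trace // JA nonemptyPn setIC -subsets_disjoint.
  by move=> At; apply: hs_closure_sub At; apply: (ideal_trace_hs sysX).
by apply: subset_trans; apply: sub_hs_closure.
Qed.

End IdealSystem.

(** * The talented monoid *)

Section OrderIdeals.
Context {k : nat} {L : kgraph k}.
Hypothesis hfin : row_finite L.
Implicit Types (v : vertex L) (H : set (vertex L)) (J : set (talented_monoid L)).

Definition tal_vertex (v : vertex L) (n : 'rV[int]_k) : talented_monoid L :=
  mon_class (@tal_rel k L) (tal_gen v n).

Lemma tal_act_vertex q v n : tal_act q (tal_vertex v n) = tal_vertex v (n + q).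
Proof. exact: tal_act_class. Qed.

Lemma mon_class_sum X (R : mon_term X -> mon_term X -> Prop) ts :
  mon_class R (mon_sum ts) = \sum_(t <- ts) mon_class R t.
Proof. by elim: ts => [|t ts IH]; rewrite ?big_nil // big_cons -IH -mon_classD. Qed.

Lemma tal_vertex_sum v n m e : uniq e -> [set` e] = paths_from v m ->
  tal_vertex v n = \sum_(a <- e) tal_vertex (src a) (n + zdeg m).
Proof.
move=> ue eE; have /mon_rel/mon_classP := TalRel n ue eE.
by rewrite mon_class_sum big_map.
Qed.

Lemma tal_le_trans (x y z : talented_monoid L) :
  tal_le x y -> tal_le y z -> tal_le x z.
Proof. by move=> [a ->] [b ->]; exists (a + b); rewrite addrA. Qed.

Lemma tal_le_addr (x y : talented_monoid L) : tal_le x (x + y).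
Proof. by exists y. Qed.

Lemma tal_le_addl (x y : talented_monoid L) : tal_le x (y + x).
Proof. by exists y; rewrite addrC. Qed.

(** The left side is one summand of the relation that expands the right side in degree [deg l]. *)
Lemma tal_le_src l n :
  tal_le (tal_vertex (src l) (n + zdeg (deg l))) (tal_vertex (rng l : vertex L) n).
Proof.
have [e ue eE] := paths_from_enum hfin (rng l) (deg l).
rewrite (tal_vertex_sum n ue eE); have le : l \in e by have : [set` e] l by rewrite eE.
by rewrite (big_rem l) //=; apply: tal_le_addr.
Qed.

Lemma order_ideal_vertex J v n : is_order_ideal J ->
  J (tal_vertex v n) <-> J (tal_vertex v 0).
Proof.
move=> [_ _ _ Jact]; split=> [/(Jact (- n))|/(Jact n)].
  by rewrite tal_act_vertex subrr.
by rewrite tal_act_vertex add0r.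
Qed.

Lemma order_idealD J x y : is_order_ideal J -> J (x + y) <-> J x /\ J y.
Proof.
move=> [J0 JD Jle _]; split=> [Jxy|[]]; last exact: JD.
by split; apply: Jle Jxy; [apply: tal_le_addr|apply: tal_le_addl].
Qed.

Lemma order_ideal_trace_hs J : is_order_ideal J ->
  hereditary_saturated ((tal_vertex^~ 0) @^-1` J).
Proof.
move=> IJ; split=> [l Jl|v n Jv].
  by apply/(order_ideal_vertex _ (0 + zdeg (deg l)) IJ); case: (IJ) => _ _ Jle _;
    apply: Jle Jl; apply: tal_le_src.
have [e ue eE] := paths_from_enum hfin v n.
rewrite /preimage /= (tal_vertex_sum 0 ue eE) big_seq.
case: (IJ) => J0 JD _ _; apply: (big_ind J) => // l le.
by apply/order_ideal_vertex => //; apply: Jv; have : [set` e] l by []; rewrite eE.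
Qed.

(** Membership in the order ideal attached to [H], read off a term. It is invariant under the
    congruence, so no normal form of terms is needed. *)
Fixpoint term_within H (t : mon_term (vertex L * 'rV[int]_k)) : Prop :=
  match t with
  | MonGen (v, _) => H v
  | MonZero => True
  | MonAdd t u => term_within H t /\ term_within H u
  end.

Lemma term_within_sum H m e n : term_within H
    (mon_sum [seq tal_gen (src a) (n + zdeg m) | a <- e]) <->
  (forall a : path L, a \in e -> H (src a)).
Proof.
elim: e => [|a e IH] //=; rewrite IH; split=> [[Ha He] b|He].
  by rewrite inE => /predU1P [->|/He].
by split=> [|b be]; apply: He; rewrite inE ?eqxx ?be ?orbT.
Qed.

(** Across a defining relation, heredity gives one direction and saturation the other; the monoid
    laws preserve the set of generators that occur. *)
Lemma mon_eq_term_within H t u : hereditary_saturated H ->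
  mon_eq (@tal_rel k L) t u -> term_within H t <-> term_within H u.
Proof.
move=> [h s]; elim=> /= [_ _ [v n m e ue eE]||||||t'|]; try by move=> *; tauto.
have eP a : a \in e <-> paths_from v m a by rewrite -eE.
rewrite term_within_sum; split=> /= [Hv a /eP [_ av]|He].
  by apply: h; rewrite av.
by apply: (s v m) => a /eP; apply: He.
Qed.

Lemma order_ideal_term J t : is_order_ideal J ->
  J (mon_class (@tal_rel k L) t) <-> term_within ((tal_vertex^~ 0) @^-1` J) t.
Proof.
move=> IJ; elim: t => [[v n]||t IHt u IHu] /=.
- exact: order_ideal_vertex.
- by split=> // _; case: IJ.
- by rewrite mon_classD order_idealD // IHt IHu.
Qed.

Lemma order_ideal_within H : hereditary_saturated H ->
  is_order_ideal [set x : talented_monoid L | term_within H (mon_repr x)].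
Proof.
move=> Hhs; pose classE t := mon_eq_term_within Hhs (mon_repr_class (@tal_rel k L) t).
have add x y : term_within H (mon_repr (x + y : talented_monoid L)) <->
    term_within H (mon_repr x) /\ term_within H (mon_repr y).
  by rewrite -{1}(mon_reprK x) -{1}(mon_reprK y) -mon_classD classE.
split=> /= [|x y Hx Hy|x _ [z ->] /add []//|q x].
- exact/classE.
- exact/add.
- by rewrite classE; elim: (mon_repr x) => [[]|//|t IHt u IHu []] //= /IHt ? /IHu ?.
Qed.

Lemma order_ideal_system :
  ideal_system (@is_order_ideal k L) (tal_vertex^~ 0) setI.
Proof.
split.
- exact: order_idealT.
- exact: order_ideal_trace_hs.
- move=> J1 J2 I1 I2 J12 x; rewrite -(mon_reprK x) !order_ideal_term //.
  by elim: (mon_repr x) => [[v n]||t IHt u IHu] //=; [apply: J12|move=> [/IHt ? /IHu]].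
- move=> H Hhs; eexists; first exact: (order_ideal_within Hhs).
  apply/seteqP; split=> v /=;
    by rewrite (mon_eq_term_within Hhs (mon_repr_class (@tal_rel k L) _)).
- exact: order_idealI.
- by [].
Qed.

Lemma poi_set_inj : injective (@poi_set k L).
Proof.
by move=> [P Pp] [Q Qp] /= PQ; subst Q; rewrite (Prop_irrelevance Pp Qp).
Qed.

Lemma order_ideal_tail_model :
  tail_model (fun P : prime_order_ideal L => ~` ((tal_vertex^~ 0) @^-1` poi_set P)).
Proof.
apply: (ideal_system_tail_model order_ideal_system hfin) => //.
  exact: poi_set_inj.
by move=> P; split=> [Pp|[Q <-]]; [exists (PrimeOrderIdeal Pp)|apply: poi_prop].
Qed.

(** The order ideal generated by [x]. The list of shifts may repeat, so it stands for an element of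
    [N[Z^k]]. *)
Definition order_ideal_gen (x : talented_monoid L) : set (talented_monoid L) :=
  [set z | exists s : seq 'rV[int]_k, tal_le z (\sum_(q <- s) tal_act q x)].

Lemma tal_actA p q (x : talented_monoid L) :
  tal_act p (tal_act q x) = tal_act (q + p) x.
Proof.
rewrite -(mon_reprK x) !tal_act_class; congr mon_class.
by elim: (mon_repr x) => [[v n]||t IHt u IHu] //=; rewrite ?addrA // IHt IHu.
Qed.

Lemma tal_act_id (x : talented_monoid L) : tal_act 0 x = x.
Proof.
rewrite -(mon_reprK x) tal_act_class; congr mon_class.
by elim: (mon_repr x) => [[v n]||t IHt u IHu] //=; rewrite ?addr0 // IHt IHu.
Qed.

Lemma order_ideal_genP x : is_order_ideal (order_ideal_gen x).
Proof.
split=> [|y z [s [a sE]] [t [b tE]]|y z yz [s zs]|q y [s [a sE]]].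
- by exists [::], 0; rewrite big_nil addr0.
- by exists (s ++ t), (a + b); rewrite big_cat sE tE addrACA.
- by exists s; apply: tal_le_trans zs.
- exists [seq p + q | p <- s], (tal_act q a); rewrite -tal_actD -sE big_map.
  rewrite (big_morph _ (@tal_actD _ L q) (@tal_act0 _ L q)).
  by apply: eq_bigr => p _; rewrite tal_actA.
Qed.

Lemma mem_order_ideal_gen x : order_ideal_gen x x.
Proof. by exists [:: 0], 0; rewrite big_seq1 tal_act_id addr0. Qed.

(** The coefficient of [q] is its number of occurrences in [s]. *)
Lemma tal_gract_sum (s : seq 'rV[int]_k) : exists a, forall x : talented_monoid L,
  tal_gract a x = \sum_(q <- s) tal_act q x.
Proof.
pose a : {fsfun 'rV[int]_k -> nat with 0%N} :=
  [fsfun q in [fset q | q in s]%fset => count_mem q s].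
exists a => x; rewrite -big_undup_iterop_count /tal_gract; apply/esym.
rewrite (perm_big (finsupp a)) /=.
  rewrite big_seq [RHS]big_seq; apply: eq_bigr => q.
  by rewrite mem_finsupp fsfunE; case: ifP => // + _; rewrite -Monoid.iteropE.
apply: uniq_perm; rewrite ?undup_uniq ?fset_uniq // => q.
rewrite mem_undup mem_finsupp fsfunE !inE /=; case: ifP => qs; last by rewrite eqxx.
by rewrite -lt0n -has_count has_pred1.
Qed.

(** (F1), (F2) and primeness of the filter make the complement an order ideal; (F3) corresponds to
    primeness of that ideal. *)
Lemma prime_filterP (F : set (talented_monoid L)) :
  is_prime_filter F <-> is_prime_order_ideal (~` F).
Proof.
split=> [[[[x0 Fx0] [F0 Fact] F2 F3] Fp]|[IP PT Pp]].
  have actN q x : F (tal_act q x) -> F x.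
    by move/(Fact (- q)); rewrite tal_actA subrr tal_act_id.
  split.
  - split=> [//|x y nx ny /Fp[]//|x y xy ny Fx|q x nx /actN//].
    by apply: ny; apply: F2 xy.
  - by apply/eqP => /seteqP [_ /(_ x0 Logic.I)].
  - move=> J1 J2 I1 I2 J12; apply: contrapT.
    move=> /not_orP [/existsNP [x /not_implyP [J1x /contrapT Fx]]].
    move=> /existsNP [y /not_implyP [J2y /contrapT Fy]].
    have [a [b [z [Fz zx zy]]]] := F3 x y Fx Fy; apply: (J12 z) => //; split.
      by case: (I1) => _ _ le1 _; apply: le1 zx _; apply: order_ideal_gract.
    by case: (I2) => _ _ le2 _; apply: le2 zy _; apply: order_ideal_gract.
have F_of x : ~ (~` F) x -> F x by apply: contrapT.
split; last by move=> x y; apply: contraPP => /not_orP nF; apply/(order_idealD _ _ IP).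
case: (IP) => P0 PD Ple Pact; split.
- by apply/set0P; apply: contra PT => /eqP ->; rewrite setC0.
- split=> // q x Fx; apply: F_of => /(Pact (- q)).
  by rewrite tal_actA subrr tal_act_id.
- by move=> x y Fx xy; apply: F_of => /(Ple _ _ xy).
move=> x y Fx Fy; apply: contrapT => no.
(* If (F3) failed for [x] and [y], the ideals they generate would meet only outside [F], and
   primeness would put [x] or [y] outside [F]. *)
have [|/(_ x)|/(_ y)] := Pp _ _ (order_ideal_genP x) (order_ideal_genP y).
- move=> z [[s zs] [t zt]] Fz; apply: no.
  have [a aE] := tal_gract_sum s; have [b bE] := tal_gract_sum t.
  by exists a, b, z; rewrite aE bE.
- by move/(_ (mem_order_ideal_gen x)).
- by move/(_ (mem_order_ideal_gen y)).
Qed.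

Lemma pfil_set_inj : injective (@pfil_set k L).
Proof.
by move=> [F Fp] [G Gp] /= FG; subst G; rewrite (Prop_irrelevance Fp Gp).
Qed.

Lemma prime_filter_openP (U : set (prime_filter L)) : open U <->
  exists2 D, D `<=` @is_order_ideal k L & \bigcup_(J in D) pfil_meets J = U.
Proof. by []. Qed.

(** Here the topology is given by a base: a union of base sets corresponds to the union of the
    traces, and conversely one base set is enough for a given [A]. *)
Lemma prime_filter_tail_model :
  tail_model (fun F : prime_filter L => (tal_vertex^~ 0) @^-1` pfil_set F).
Proof.
have idealC (F : prime_filter L) : is_order_ideal (~` pfil_set F).
  by have /prime_filterP [] := pfil_prop F.
(* [J] meets [F] iff it is not contained in the complement of [F]. Both are order ideals, so a
   vertex of [J] detects this. *)
have meetsP J (F : prime_filter L) : is_order_ideal J -> pfil_meets J F <->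
    ((tal_vertex^~ 0) @^-1` pfil_set F) `&` ((tal_vertex^~ 0) @^-1` J) !=set0.
  move=> IJ; split=> [|[v [Fv Jv]]]; last by exists (tal_vertex v 0).
  rewrite /pfil_meets /= -(setCK F) => JF; apply: contrapT => /nonemptyPn.
  rewrite setIC => /subsets_disjoint.
  by move/(ideal_sub_trace order_ideal_system IJ (idealC F))/subsets_disjoint/nonemptyPn.
split=> [F G FG|M|U].
- apply/pfil_set_inj/setC_inj.
  apply: (ideal_trace_inj order_ideal_system (idealC F) (idealC G)).
  by apply/seteqP; split=> v /=; apply: contra_not => Hv;
    have [h1 h2] := (seteqP _ _).1 FG; [apply: h2|apply: h1].
- split=> [Mt|[F <-]].
    have [_ /(_ M) [/(_ Mt) [P PM] _] _] := order_ideal_tail_model.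
    have Fp : is_prime_filter (~` P).
      by apply/prime_filterP; rewrite setCK; apply: poi_prop.
    by exists (PrimeFilter Fp).
  rewrite -[X in is_maximal_tail X]setCK.
  apply/(prime_idealP order_ideal_system hfin (idealC F)).
  by apply/prime_filterP/pfil_prop.
- rewrite prime_filter_openP; split=> [[D DI <-]|[A ->]].
    exists (\bigcup_(J in D) ((tal_vertex^~ 0) @^-1` J)).
    apply/seteqP; split=> F.
      move=> [J DJ /(meetsP _ _ (DI _ DJ)) [v [Fv Jv]]].
      by exists v; split=> //; exists J.
    move=> [v [Fv [J DJ Jv]]]; exists J => //.
    by apply/meetsP; [exact: DI|exists v].
  have [J IJ JA] := ideal_of_trace order_ideal_system (hs_closureP hfin A).
  exists [set J]; first by move=> _ ->.
  rewrite bigcup_set1; apply/seteqP; split=> F; rewrite meetsP // JA.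
    move=> FA; apply: contrapT => /nonemptyPn; rewrite setIC.
    rewrite -[X in _ `&` X]setCK => /subsets_disjoint AF.
    move: FA => [v [Fv /(hs_closure_sub _ AF)]]; apply=> //.
    exact: (order_ideal_trace_hs (idealC F)).
  by move=> [v [Fv Av]]; exists v; split=> //; apply: sub_hs_closure.
Qed.

End OrderIdeals.

(** * The Kumjian-Pask algebra *)

Lemma zdegD k (m n : 'rV[nat]_k) : zdeg (m + n) = zdeg m + zdeg n.
Proof. by apply/rowP => i; rewrite !mxE. Qed.

Lemma zdeg_inj k : injective (@zdeg k).
Proof.
by move=> m n /rowP mn; apply/rowP => i; have := mn i; rewrite !mxE => -[].
Qed.

Section KumjianPaskSpan.
Context {K : fieldType} {k : nat} {L : kgraph k}.
Hypothesis hfin : row_finite L.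
Implicit Types (v : vertex L) (l m a b : path L) (x y : kumjian_pask K L).

Local Notation "x ** y" := (kp_mul x y) (at level 40, left associativity).

Definition kp_vertex v : kumjian_pask K L := kp_of_gen K (KPp v).

(* s_l and s_{l^*}, extended to paths of degree 0 by the vertex projections. *)
Definition kp_path l : kumjian_pask K L :=
  if insub l is Some l' then kp_of_gen K (KPs l') else kp_vertex (rng l).

Definition kp_star l : kumjian_pask K L :=
  if insub l is Some l' then kp_of_gen K (KPsstar l') else kp_vertex (rng l).

Lemma kp_path_val (l : nonvertex_path L) : kp_path (val l) = kp_of_gen K (KPs l).
Proof. by rewrite /kp_path valK. Qed.

Lemma kp_star_val (l : nonvertex_path L) : kp_star (val l) = kp_of_gen K (KPsstar l).
Proof. by rewrite /kp_star valK. Qed.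

Lemma kp_path_ident v : kp_path (ident v) = kp_vertex v.
Proof. by rewrite /kp_path insubF ?rng_ident // deg_ident eqxx. Qed.

Lemma kp_star_ident v : kp_star (ident v) = kp_vertex v.
Proof. by rewrite /kp_star insubF ?rng_ident // deg_ident eqxx. Qed.

(** The case split that extends each defining relation to paths of degree 0. *)
Lemma nonvertex_pathP l :
  (exists v, l = ident v) \/ exists l' : nonvertex_path L, l = val l'.
Proof.
have [l0|l0] := eqVneq (deg l) 0.
  by left; exists (rng l); apply: deg0_ident.
by right; exists (exist _ l l0).
Qed.

Lemma kp_relE t u :
  kp_rel t u -> alg_class (@kp_rel K k L) t = alg_class (@kp_rel K k L) u.
Proof. by move=> tu; apply/alg_classP/alg_rel. Qed.

Let mulE := palg_mul_class (@kp_rel K k L).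

Lemma kp_vertex_mul u v :
  kp_vertex u ** kp_vertex v = if u == v then kp_vertex u else 0.
Proof. by have := kp_relE (KPpp K u v); rewrite mulE; case: ifP. Qed.

Lemma kp_vertex_idem v : kp_vertex v ** kp_vertex v = kp_vertex v.
Proof. by rewrite kp_vertex_mul eqxx. Qed.

Lemma kp_rng_path l : kp_vertex (rng l) ** kp_path l = kp_path l.
Proof.
have [[v ->]|[l' ->]] := nonvertex_pathP l.
  by rewrite kp_path_ident rng_ident kp_vertex_idem.
by rewrite kp_path_val; have := kp_relE (KPps K l'); rewrite mulE.
Qed.

Lemma kp_path_src l : kp_path l ** kp_vertex (src l) = kp_path l.
Proof.
have [[v ->]|[l' ->]] := nonvertex_pathP l.
  by rewrite kp_path_ident src_ident kp_vertex_idem.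
by rewrite kp_path_val; have := kp_relE (KPsp K l'); rewrite mulE.
Qed.

Lemma kp_src_star l : kp_vertex (src l) ** kp_star l = kp_star l.
Proof.
have [[v ->]|[l' ->]] := nonvertex_pathP l.
  by rewrite kp_star_ident src_ident kp_vertex_idem.
by rewrite kp_star_val; have := kp_relE (KPpsstar K l'); rewrite mulE.
Qed.

Lemma kp_star_rng l : kp_star l ** kp_vertex (rng l) = kp_star l.
Proof.
have [[v ->]|[l' ->]] := nonvertex_pathP l.
  by rewrite kp_star_ident rng_ident kp_vertex_idem.
by rewrite kp_star_val; have := kp_relE (KPsstarp K l'); rewrite mulE.
Qed.

Lemma deg_comp_neq0 (l : nonvertex_path L) m :
  src (val l) = rng m -> deg (comp (val l) m) != 0.
Proof.
move=> lm; rewrite deg_comp //; apply: contraNneq (valP l) => /rowP lm0.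
apply/eqP/rowP => i; have := lm0 i; rewrite !mxE => /eqP.
by rewrite addn_eq0 => /andP [/eqP].
Qed.

Lemma kp_path_comp l m : src l = rng m -> kp_path l ** kp_path m = kp_path (comp l m).
Proof.
have [[v ->]|[l' ->]] := nonvertex_pathP l.
  by rewrite src_ident kp_path_ident => ->; rewrite comp_identl kp_rng_path.
have [[v ->]|[m' ->]] := nonvertex_pathP m.
  by rewrite rng_ident kp_path_ident => <-; rewrite comp_identr kp_path_src.
move=> lm; pose n : nonvertex_path L := exist _ (comp _ _) (deg_comp_neq0 lm).
rewrite !kp_path_val -[comp _ _]/(val n) kp_path_val.
by have := kp_relE (KPss K lm (erefl (val n))); rewrite mulE.
Qed.

Lemma kp_star_comp l m : src l = rng m -> kp_star m ** kp_star l = kp_star (comp l m).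
Proof.
have [[v ->]|[l' ->]] := nonvertex_pathP l.
  by rewrite src_ident kp_star_ident => ->; rewrite comp_identl kp_star_rng.
have [[v ->]|[m' ->]] := nonvertex_pathP m.
  by rewrite rng_ident kp_star_ident => <-; rewrite comp_identr kp_src_star.
move=> lm; pose n : nonvertex_path L := exist _ (comp _ _) (deg_comp_neq0 lm).
rewrite !kp_star_val -[comp _ _]/(val n) kp_star_val.
by have := kp_relE (KPsstarsstar K lm (erefl (val n))); rewrite mulE.
Qed.

Lemma kp_star_path l m : deg l = deg m ->
  kp_star l ** kp_path m = if l == m then kp_vertex (src l) else 0.
Proof.
have [[v ->]|[l' ->]] := nonvertex_pathP l.
  rewrite deg_ident => /esym/deg0_ident ->.
  rewrite kp_star_ident kp_path_ident kp_vertex_mul src_ident.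
  by rewrite (can_eq (@src_ident k L)).
have [[v ->]|[m' ->]] := nonvertex_pathP m.
  by rewrite deg_ident => l0; have := valP l'; rewrite l0 eqxx.
move=> lm; rewrite kp_star_val kp_path_val (inj_eq val_inj).
by have := kp_relE (KPsstars K lm); rewrite mulE; case: ifP.
Qed.

Lemma kp_mul_suml I (r : seq I) (P : pred I) (F : I -> kumjian_pask K L) x :
  (\sum_(i <- r | P i) F i) ** x = \sum_(i <- r | P i) F i ** x.
Proof. exact: (big_morph _ (fun y z => kp_mulDl y z x) (kp_mul0l x)). Qed.

Lemma kp_mul_sumr I (r : seq I) (P : pred I) (F : I -> kumjian_pask K L) x :
  x ** (\sum_(i <- r | P i) F i) = \sum_(i <- r | P i) x ** F i.
Proof. exact: (big_morph _ (kp_mulDr x) (kp_mul0r x)). Qed.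

Lemma kp_scaleAl c x y : c *: (x ** y) = (c *: x) ** y.
Proof. exact: palg_scaleAl. Qed.

Lemma kp_scaleAr c x y : c *: (x ** y) = x ** (c *: y).
Proof. exact: palg_scaleAr. Qed.

Lemma alg_class_sum X (R : alg_term K X -> alg_term K X -> Prop) ts :
  alg_class R (alg_sum ts) = \sum_(t <- ts) alg_class R t.
Proof. by elim: ts => [|t ts IH]; rewrite ?big_nil // big_cons -IH -alg_classD. Qed.

Lemma kp_vertex_sum v n (e : seq (path L)) : uniq e -> [set` e] = paths_from v n ->
  kp_vertex v = \sum_(l <- e) kp_path l ** kp_star l.
Proof.
move=> ue eE; have eP a : a \in e <-> paths_from v n a by rewrite -eE.
have [n0|n0] := eqVneq n 0.
  rewrite (perm_big [:: ident v]) ?big_seq1; last first.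
    apply: uniq_perm => // a; apply/idP/idP; rewrite inE.
      by move=> /eP [+ <-]; rewrite n0 => /deg0_ident/eqP.
    by move=> /eqP ->; apply/eP; split; rewrite ?deg_ident ?rng_ident.
  by rewrite kp_path_ident kp_star_ident kp_vertex_idem.
(* Every path in [e] has degree [n], which is nonzero here, so [pmap insub] drops nothing. *)
pose e' : seq (nonvertex_path L) := pmap insub e.
have e'E : map val e' = e.
  rewrite /e' (pmap_filter (@insubK _ _ _)); apply/all_filterP/allP => a /eP [an _].
  by rewrite /= isSome_insub an.
have := @KPsum K k L v n e' n0; rewrite -(map_inj_uniq val_inj) e'E => /(_ ue eE)/kp_relE.
rewrite /kp_vertex /kp_of_gen => ->; rewrite alg_class_sum -e'E !big_map.
by apply: eq_bigr => l _; rewrite mulE kp_path_val kp_star_val.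
Qed.

(** The analogue of a matrix unit; see [kp_unit_mul_same]. *)
Definition kp_unit l m := kp_path l ** kp_star m.

(** Inserting the vertex projection at [src l], expanded in degree [n], between the factors raises
    both degrees by [n]. *)
Lemma kp_unit_expand l m n e : src l = src m -> uniq e ->
  [set` e] = paths_from (src l) n ->
  kp_unit l m = \sum_(a <- e) kp_unit (comp l a) (comp m a).
Proof.
move=> lm ue eE; rewrite /kp_unit -(kp_path_src l) (kp_vertex_sum ue eE).
rewrite kp_mul_sumr kp_mul_suml big_seq [RHS]big_seq; apply: eq_bigr => a ae.
have [_ ra] : paths_from (src l) n a by rewrite -eE.
by rewrite kp_mulA kp_path_comp // -kp_mulA kp_star_comp // -lm.
Qed.

Lemma kp_unit_mul_same l m a b : deg m = deg a -> src l = src m ->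
  kp_unit l m ** kp_unit a b = if m == a then kp_unit l b else 0.
Proof.
move=> ma lm; rewrite /kp_unit kp_mulA -[_ ** kp_path a]kp_mulA kp_star_path //.
by case: ifP => _; rewrite -?lm ?kp_path_src // kp_mul0r kp_mul0l.
Qed.

(** The degree condition is additive to avoid a difference of degrees; [D] later confines all second
    paths to one degree. *)
Definition kp_homog_units (n : 'rV[int]_k) (D : set 'rV[nat]_k) :
    set (kumjian_pask K L) :=
  [set x | exists c l m, [/\ src l = src m, zdeg (deg l) = n + zdeg (deg m),
     D (deg m) & x = c *: kp_unit l m]].

Lemma kp_homog_spanP n x : kp_homog n x -> finite_sums (kp_homog_units n setT) x.
Proof.
elim=> {n x} [g|n|n x y _ Sx _ Sy|n c x _ Sx|m n x y _ Sx _ Sy].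
- apply: finite_sums_gen; exists 1.
  case: g => [v|l|l] /=.
  + exists (ident v), (ident v); split=> //; rewrite ?add0r //.
    by rewrite scale1r /kp_unit kp_path_ident kp_star_ident kp_vertex_idem.
  + exists (val l), (ident (src (val l))); rewrite src_ident deg_ident; split=> //.
      by rewrite -zdegD addr0.
    by rewrite scale1r /kp_unit kp_star_ident kp_path_src kp_path_val.
  + exists (ident (src (val l))), (val l); rewrite src_ident deg_ident; split=> //.
      by rewrite addNr; apply/rowP => i; rewrite !mxE.
    by rewrite scale1r /kp_unit kp_path_ident kp_src_star kp_star_val.
- exact: finite_sums0.
- exact: finite_sumsD.
- move: Sx; apply: (finite_sums_map (f := *:%R c)).
  + exact: scaler0.
  + exact: scalerDr.
  move=> _ [b [l [m [lm dlm _ ->]]]]; apply: finite_sums_gen.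
  by exists (c * b), l, m; rewrite scalerA.
- move: Sx; apply: (finite_sums_map (f := fun u => u ** y)).
  + exact: kp_mul0l.
  + by move=> u v; apply: kp_mulDl.
  move=> _ [c [l [l' [ll' dl _ ->]]]]; move: Sy.
  apply: (finite_sums_map (f := kp_mul (c *: kp_unit l l'))).
  + exact: kp_mul0r.
  + exact: kp_mulDr.
  move=> _ [d [a [b [ab da _ ->]]]].
  (* Expanding the left unit by [deg a] and the right one by [deg l'] gives the two inner paths the
     same degree, so the units multiply like matrix units. *)
  have [e ue eE] := paths_from_enum hfin (src l) (deg a).
  have [f uf fE] := paths_from_enum hfin (src a) (deg l').
  rewrite -kp_scaleAl -kp_scaleAr scalerA (kp_unit_expand ll' ue eE).
  rewrite (kp_unit_expand ab uf fE) kp_mul_suml scaler_sumr big_seq.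
  apply: (big_ind (finite_sums _)); first exact: finite_sums0.
    exact: finite_sumsD.
  move=> l1 l1e; have [dl1 rl1] : paths_from (src l) (deg a) l1 by rewrite -eE.
  rewrite kp_mul_sumr scaler_sumr big_seq.
  apply: (big_ind (finite_sums _)); first exact: finite_sums0.
    exact: finite_sumsD.
  move=> a1 a1f; have [da1 ra1] : paths_from (src a) (deg l') a1 by rewrite -fE.
  have [s1 s2 s3 s4] : [/\ src l = rng l1, src l' = rng l1, src a = rng a1 &
      src b = rng a1].
    by rewrite rl1 ra1 -ll' -ab.
  rewrite kp_unit_mul_same; first last.
  + by rewrite !src_comp.
  + by rewrite !deg_comp // dl1 da1 addrC.
  case: eqP => [e1|_]; last by rewrite scaler0; apply: finite_sums0.
  apply: finite_sums_gen; exists (c * d), (comp l l1), (comp b a1); split=> //.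
  + by rewrite src_comp // -(src_comp s2) e1 !src_comp.
  + rewrite !deg_comp // !zdegD dl dl1 da1 da.
    by rewrite addrACA [X in _ + X = _]addrC.
Qed.

(** The common degree is the sum of all [deg (m i)]: each unit is expanded by the degrees of the
    others. *)
Lemma kp_homog_level n x : kp_homog n x ->
  exists N, finite_sums (kp_homog_units n [set N]) x.
Proof.
move=> /kp_homog_spanP [r [y [yu ->]]].
have /choice [c /choice [l /choice [m y_unit]]] := yu.
exists (\sum_i deg (m i)); apply: (big_ind (finite_sums _)).
- exact: finite_sums0.
- exact: finite_sumsD.
move=> i _; have [lm dl _ ->] := y_unit i.
have [e ue eE] := paths_from_enum hfin (src (l i)) (\sum_(j | j != i) deg (m j)).
rewrite (kp_unit_expand lm ue eE) scaler_sumr [X in finite_sums _ X]big_seq.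
apply: (big_ind (finite_sums _)); first exact: finite_sums0.
  exact: finite_sumsD.
move=> a ae; have [da ra] : paths_from (src (l i)) (\sum_(j | j != i) deg (m j)) a.
  by rewrite -eE.
have ra' : src (m i) = rng a by rewrite -lm.
apply: finite_sums_gen; exists (c i), (comp (l i) a), (comp (m i) a); split=> //.
- by rewrite !src_comp.
- by rewrite !deg_comp // !zdegD dl addrA.
- by rewrite /= deg_comp // da [RHS](bigD1 i).
Qed.

Lemma kp_homog_normal n x : kp_homog n x ->
  exists (Q : seq (path L * path L)) (c : path L * path L -> K) N,
  [/\ uniq Q, forall q, q \in Q -> [/\ src q.1 = src q.2,
        zdeg (deg q.1) = n + zdeg N & deg q.2 = N] &
      x = \sum_(q <- Q) c q *: kp_unit q.1 q.2].
Proof.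
move=> /kp_homog_level [N [r [y [yu ->]]]].
have /choice [c /choice [l /choice [m y_unit]]] := yu.
pose f i := (l i, m i).
(* Equal pairs are collected and their coefficients added, so some coefficients may become zero. *)
exists (undup (codom f)), (fun q => \sum_(i | f i == q) c i), N; split.
- exact: undup_uniq.
- move=> q; rewrite mem_undup => /codomP [i ->] /=.
  by have [lm dl <- _] := y_unit i.
under [RHS]eq_bigr do rewrite scaler_suml.
rewrite (exchange_big_dep xpredT) //=; apply: eq_bigr => i _.
rewrite -big_filter (perm_big [:: f i]) ?big_seq1; first by have [] := y_unit i.
apply: uniq_perm => [||q]; rewrite ?filter_uniq ?undup_uniq // mem_filter inE.
by rewrite eq_sym andb_idr // => /eqP ->; rewrite mem_undup codom_f.
Qed.

(** Compressing a homogeneous element of [I] puts a vertex projection in [I], hence in [J];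
    multiplying back by the path and the starred path puts the corresponding term in [J]. *)
Lemma ideal_trace_sub_graded (I J : set (kumjian_pask K L)) :
  is_graded_ideal I -> is_ideal J ->
  kp_vertex @^-1` I `<=` kp_vertex @^-1` J -> I `<=` J.
Proof.
move=> [II Ig] JI IJ x /Ig; have [J0 _ Jl Jr] := JI; have [_ _ Il Ir] := II.
apply: ideal_finite_sums => // {}x [Ix [n _ /kp_homog_normal]].
move=> [Q [c [N [uQ QP xE]]]]; rewrite xE big_seq; apply: (big_ind J) => //.
  by move=> *; apply: ideal_add.
move=> q qQ; have [sq dq1 dq2] := QP q qQ.
have [->|cq] := eqVneq (c q) 0; first by rewrite scale0r.
(* All first paths share one degree and all second paths another, so every pair other than [q] is
   annihilated. *)
have compress : kp_star q.1 ** x ** kp_path q.2 = c q *: kp_vertex (src q.1).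
  rewrite xE kp_mul_sumr kp_mul_suml (bigD1_seq q) //= big1_seq ?addr0.
    rewrite -kp_scaleAr -kp_scaleAl /kp_unit kp_mulA kp_star_path // eqxx.
    by rewrite -!kp_mulA kp_star_path // eqxx -sq kp_vertex_idem.
  move=> t /andP [tq tQ]; have [st dt1 dt2] := QP t tQ.
  rewrite -kp_scaleAr -kp_scaleAl /kp_unit kp_mulA.
  rewrite kp_star_path; last by apply: zdeg_inj; rewrite dq1 dt1.
  case: eqP => [q1|_]; last by rewrite !kp_mul0l scaler0.
  rewrite -kp_mulA kp_star_path ?dt2 ?dq2 //; case: eqP => [q2|_].
    by move: tq; rewrite (surjective_pairing t) -q1 q2 -surjective_pairing eqxx.
  by rewrite kp_mul0r scaler0.
have Jv : J (kp_vertex (src q.1)).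
  apply: IJ; rewrite /preimage /= -[kp_vertex _]scale1r -(mulVf cq) -scalerA.
  by rewrite -compress !kp_scaleAl; apply/Ir/Il.
rewrite /kp_unit -(kp_path_src q.1) !kp_scaleAl; apply: (Jr); exact: (Jl).
Qed.

(** The projection at [src l] is that at [rng l] multiplied by [kp_star l] on the left and
    [kp_path l] on the right; saturation comes from [kp_vertex_sum]. *)
Lemma ideal_trace_hs_kp I : is_ideal I ->
  hereditary_saturated (kp_vertex @^-1` I).
Proof.
move=> II; have [I0 _ Il Ir] := II; split=> [l Iv|v n Iv].
  have := kp_star_path (erefl (deg l)); rewrite eqxx /preimage /= => <-.
  by rewrite -kp_rng_path; apply/Il/Ir.
have [e ue eE] := paths_from_enum hfin v n.
rewrite /preimage /= (kp_vertex_sum ue eE) big_seq; apply: (big_ind I) => //.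
  by move=> *; apply: ideal_add.
move=> l le; rewrite -(kp_path_src l); apply/Ir/Il/Iv.
by have : [set` e] l by []; rewrite eE.
Qed.

End KumjianPaskSpan.

(** * The action on functions on paths *)

Section PathRepresentation.
Context {K : fieldType} {k : nat} {L : kgraph k}.
Implicit Types (v : vertex L) (l m a b : path L) (t u : alg_term K (kp_gen L)).
Implicit Types (f g : path L -> K).

(** The partial inverse of composition with [l] on the left; the chosen path is unique by
    [comp_inj]. *)
Definition path_suffix l m : option (path L) :=
  if pselect (exists b, src l = rng b /\ m = comp l b) is left h
  then Some (sval (cid h)) else None.

Lemma path_suffix_comp l b : src l = rng b -> path_suffix l (comp l b) = Some b.
Proof.
move=> lb; rewrite /path_suffix; case: pselect => [h|[]]; last by exists b.
by case: (cid h) => b' /= [lb' /comp_inj] [] // _ ->.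
Qed.

Lemma path_suffixP l m b :
  path_suffix l m = Some b <-> src l = rng b /\ m = comp l b.
Proof.
split=> [|[lb ->]]; last exact: path_suffix_comp.
by rewrite /path_suffix; case: pselect => // h [<-]; case: (cid h).
Qed.

Lemma path_suffix_mul l n m : src l = rng n ->
  path_suffix (comp l n) m = obind (path_suffix n) (path_suffix l m).
Proof.
move=> ln; case E : (path_suffix l m) => [b|] /=.
  have [lb ->] := (path_suffixP _ _ _).1 E.
  case E2 : (path_suffix n b) => [b'|].
    have [nb' ->] := (path_suffixP _ _ _).1 E2.
    by apply/path_suffixP; rewrite src_comp // compA.
  case E3 : (path_suffix _ _) => [b'|//].
  have [] := (path_suffixP _ _ _).1 E3; rewrite src_comp // => nb'.
  rewrite -compA // => /comp_inj []; rewrite ?rng_comp // => _ bE.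
  by rewrite bE path_suffix_comp in E2.
case E3 : (path_suffix _ _) => [b'|//].
have [] := (path_suffixP _ _ _).1 E3; rewrite src_comp // => nb' mE.
by move: E; rewrite mE -compA // path_suffix_comp // rng_comp.
Qed.

(** [KPs l] sends the indicator function of a path [b] with range [src l] to that of [comp l b].
    Infinite supports are allowed, so that constant functions can be used as test functions. *)
Fixpoint path_rep t f : path L -> K :=
  match t with
  | AlgGen (KPp v) => fun m => if rng m == v then f m else 0
  | AlgGen (KPs l) => fun m => oapp f 0 (path_suffix (val l) m)
  | AlgGen (KPsstar l) =>
      fun m => if rng m == src (val l) then f (comp (val l) m) else 0
  | AlgZero => fun=> 0
  | AlgAdd t u => fun m => path_rep t f m + path_rep u f m
  | AlgScale c t => fun m => c * path_rep t f m
  | AlgMul t u => path_rep t (path_rep u f)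
  end.

Lemma path_repD t f g m :
  path_rep t (fun n => f n + g n) m = path_rep t f m + path_rep t g m.
Proof.
elim: t f g m => [[v|l|l]||t IHt u IHu|c t IHt|t IHt u IHu] f g m /=.
- by case: ifP; rewrite ?addr0.
- by case: path_suffix; rewrite /= ?addr0.
- by case: ifP; rewrite ?addr0.
- by rewrite addr0.
- by rewrite IHt IHu addrACA.
- by rewrite IHt mulrDr.
- by rewrite -IHt; congr (path_rep t _ _); apply: funext => n; apply: IHu.
Qed.

Lemma path_repZ t c f m : path_rep t (fun n => c * f n) m = c * path_rep t f m.
Proof.
elim: t f m => [[v|l|l]||t IHt u IHu|d t IHt|t IHt u IHu] f m /=.
- by case: ifP; rewrite ?mulr0.
- by case: path_suffix; rewrite /= ?mulr0.
- by case: ifP; rewrite ?mulr0.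
- by rewrite mulr0.
- by rewrite IHt IHu mulrDr.
- by rewrite IHt mulrCA.
- by rewrite -IHt; congr (path_rep t _ _); apply: funext => n; apply: IHu.
Qed.

Lemma path_rep_sum (ts : seq (alg_term K (kp_gen L))) f m :
  path_rep (alg_sum ts) f m = \sum_(t <- ts) path_rep t f m.
Proof. by elim: ts => [|t ts IH]; rewrite ?big_nil // big_cons -IH. Qed.

Variable H : set (vertex L).
Hypothesis Hhs : hereditary_saturated H.

(* The relation p_v = \sum s_l s_l^* only holds on functions of paths up to this
   equivalence, since it fails on the paths shorter than the l. *)
Definition eventually_eq f g :=
  exists N, forall m, (exists n, deg m = N + n) -> ~ H (src m) -> f m = g m.

Lemma eventually_eq_refl f : eventually_eq f f.
Proof. by exists 0. Qed.

Lemma eventually_eq_sym f g : eventually_eq f g -> eventually_eq g f.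
Proof. by move=> [N fg]; exists N => m mN mH; rewrite fg. Qed.

Lemma eventually_eq2 (f1 g1 f2 g2 f g : path L -> K) :
  eventually_eq f1 g1 -> eventually_eq f2 g2 ->
  (forall m, f1 m = g1 m -> f2 m = g2 m -> f m = g m) -> eventually_eq f g.
Proof.
move=> [N1 fg1] [N2 fg2] fg; exists (N1 + N2) => m [n mn] mH.
apply: fg; [apply: fg1|apply: fg2] => //.
  by exists (N2 + n); rewrite addrA.
by exists (N1 + n); rewrite addrA [N2 + _]addrC.
Qed.

Lemma eventually_eq_trans f g h :
  eventually_eq f g -> eventually_eq g h -> eventually_eq f h.
Proof. by move=> fg gh; apply: (eventually_eq2 fg gh) => m ->. Qed.

(** [KPs l] raises the bound by its degree, and [KPsstar l] evaluates at longer paths; in both cases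
    the source does not change, so it stays outside [H]. *)
Lemma path_rep_eventually t f g :
  eventually_eq f g -> eventually_eq (path_rep t f) (path_rep t g).
Proof.
elim: t f g => [[v|l|l]||t IHt u IHu|c t IHt|t IHt u IHu] f g fg /=.
- by apply: (eventually_eq2 fg fg) => m ->.
- case: fg => N fg; exists (N + deg (val l)) => m [n mn] mH.
  case E : path_suffix => [b|//] /=; have [lb mE] := (path_suffixP _ _ _).1 E.
  apply: fg; last by move: mH; rewrite mE src_comp.
  exists n; apply: (@rVnat_addI _ (deg (val l))).
  by rewrite -deg_comp // -mE mn addrA [N + _]addrC.
- case: fg => N fg; exists N => m [n mn] mH; case: eqP => // ml.
  apply: fg; last by rewrite src_comp.
  by exists (deg (val l) + n); rewrite deg_comp // mn addrCA.
- exact: eventually_eq_refl.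
- by apply: (eventually_eq2 (IHt _ _ fg) (IHu _ _ fg)) => m -> ->.
- by apply: (eventually_eq2 (IHt _ _ fg) (IHt _ _ fg)) => m ->.
- by apply/IHt/IHu.
Qed.

(** All relations but the last hold at every path. For the last, a path of degree at least [n] has
    exactly one initial segment of degree [n], and only its term contributes. *)
Lemma path_rep_rel t u f : kp_rel t u ->
  eventually_eq (path_rep t f) (path_rep u f).
Proof.
have now f' g' : f' =1 g' -> eventually_eq f' g' by exists 0.
case=> {t u} [v w|l m n lm nE|l m n lm nE|l|l|l|l|l m dlm|v n e n0 ue eE].
- apply: now => m; rewrite /=; case: (eqVneq v w) => [->|vw] /=; first by case: eqP.
  by case: eqP => // ->; rewrite (negPf vw).
- by apply: now => p; rewrite /= nE path_suffix_mul //; case: path_suffix.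
- apply: now => p; rewrite /= nE src_comp //; case: eqP => // pm.
  by rewrite rng_comp // -lm eqxx compA.
- apply: now => p /=; case: eqP => // pl; case E : path_suffix => [b|//].
  by have [lb mE] := (path_suffixP _ _ _).1 E; rewrite mE rng_comp in pl.
- apply: now => p /=; case E : path_suffix => [b|//] /=.
  by have [lb mE] := (path_suffixP _ _ _).1 E; rewrite -lb eqxx.
- by apply: now => p /=; case: eqP.
- by apply: now => p /=; case: eqP => // pl; rewrite rng_comp // eqxx.
- apply: now => p /=; case: eqP => [pl|pl].
    case: eqP => [<-|lm] /=; first by rewrite pl eqxx path_suffix_comp.
    case E : path_suffix => [b|//]; case: lm; apply: val_inj.
    have [mb] := (path_suffixP _ _ _).1 E.
    by move=> /(comp_inj (esym pl) mb dlm) [].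
  by case: ifP => //= _; case: eqP.
- exists n => p [n' pn] _; rewrite path_rep_sum big_map /=.
  have eP a : a \in map val e <-> paths_from v n a by rewrite -eE.
  have [a [b [ab da db pE]]] := path_factor pn.
  have termE (l : nonvertex_path L) : l \in e ->
      path_rep (AlgMul (AlgGen (KPs l)) (AlgGen (KPsstar l))) f p =
      if val l == a then f p else 0.
    move=> le; have [dl rl] : paths_from v n (val l) by apply/eP/map_f.
    rewrite /= pE; case: eqP => [->|la].
      by rewrite path_suffix_comp //= ab eqxx.
    case E : path_suffix => [b'|//]; case: la.
    have [lb] := (path_suffixP _ _ _).1 E.
    by move=> /(comp_inj ab lb); rewrite da dl => -[].
  rewrite big_seq (eq_bigr _ termE) -big_seq.
  rewrite -(big_map val xpredT (fun l => if l == a then f p else 0)).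
  rewrite pE rng_comp // -pE; case: eqP => [rav|rav].
    have ae : a \in map val e by apply/eP.
    rewrite (bigD1_seq a) //= ?(map_inj_uniq val_inj) // eqxx big1 ?addr0 //.
    by move=> l /negPf ->.
  rewrite big1_seq // => l /andP [_ /eP [_ rl]].
  by case: eqP => // la; rewrite -la rl in rav.
Qed.

Lemma path_rep_alg_eq t u f : alg_eq (@kp_rel K k L) t u ->
  eventually_eq (path_rep t f) (path_rep u f).
Proof.
have now f' g' : f' =1 g' -> eventually_eq f' g' by exists 0.
move=> tu; elim: tu f => {t u}.
- by move=> t u tu f; apply: path_rep_rel.
- by move=> *; apply: eventually_eq_refl.
- by move=> t u _ IH f; apply: eventually_eq_sym.
- by move=> t u w _ IH1 _ IH2 f; apply: eventually_eq_trans (IH1 f) (IH2 f).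
- move=> t t' u u' _ IH1 _ IH2 f.
  by apply: (eventually_eq2 (IH1 f) (IH2 f)) => m /= -> ->.
- by move=> a t t' _ IH f; apply: (eventually_eq2 (IH f) (IH f)) => m /= ->.
- move=> t t' u u' _ IH1 _ IH2 f /=.
  exact: eventually_eq_trans (path_rep_eventually t (IH2 f)) (IH1 _).
- by move=> t u w f; apply: now => m /=; rewrite addrA.
- by move=> t u f; apply: now => m /=; rewrite addrC.
- by move=> t f; apply: now => m /=; rewrite add0r.
- by move=> t f; apply: now => m /=; rewrite mulN1r addNr.
- by move=> a b t f; apply: now => m /=; rewrite mulrA.
- by move=> t f; apply: now => m /=; rewrite mul1r.
- by move=> a t u f; apply: now => m /=; rewrite mulrDr.
- by move=> a b t f; apply: now => m /=; rewrite mulrDl.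
- by move=> t u w f; apply: eventually_eq_refl.
- by move=> t u w f; apply: eventually_eq_refl.
- by move=> t u w f; apply: now => m /=; rewrite path_repD.
- by move=> a t u f; apply: eventually_eq_refl.
- by move=> a t u f; apply: now => m /=; rewrite path_repZ.
Qed.

Definition kp_ideal_gen : set (kumjian_pask K L) :=
  finite_sums [set x | exists y z v, H v /\ x = kp_mul (kp_mul y (kp_vertex v)) z].

(** Splitting [y] and then [z] into homogeneous parts suffices, because vertex projections have
    degree 0. *)
Lemma kp_ideal_gen_graded : is_graded_ideal kp_ideal_gen.
Proof.
have gen y z v : H v -> kp_ideal_gen (kp_mul (kp_mul y (kp_vertex v)) z).
  by move=> Hv; apply: finite_sums_gen; exists y, z, v.
split.
  apply: finite_sums_ideal => [x|x' x|x x'] [y [z [v [Hv ->]]]].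
  - by exists (- y), z, v; rewrite !kp_mulNl.
  - by exists (kp_mul x' y), z, v; rewrite !kp_mulA.
  - by exists y, (kp_mul z x'), v; rewrite !kp_mulA.
apply: finite_sums_sub; first exact: finite_sums0.
  by move=> *; apply: finite_sumsD.
move=> _ [y [z [v [Hv ->]]]]; move: (kp_homog_sums y).
apply: (finite_sums_map (f := fun y => kp_mul (kp_mul y (kp_vertex v)) z)).
- by rewrite !kp_mul0l.
- by move=> x x'; rewrite !kp_mulDl.
move=> {}y [m _ am]; move: (kp_homog_sums z).
apply: (finite_sums_map (f := kp_mul (kp_mul y (kp_vertex v)))).
- exact: kp_mul0r.
- exact: kp_mulDr.
move=> {}z [n _ bn]; apply: finite_sums_gen; split; first exact: gen.
exists (m + 0 + n) => //; do 2?apply: kp_homogM => //.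
exact: (kp_homog_gen K (KPp v)).
Qed.

(** For [v] in [H], a path with range [v] has its source in [H] by heredity, so the projection at
    [v] sends every function to one equivalent to zero. *)
Lemma kp_ideal_gen_rep x f : kp_ideal_gen x ->
  eventually_eq (path_rep (alg_repr x) f) (fun=> 0).
Proof.
have repE t g : eventually_eq (path_rep (alg_repr (alg_class (@kp_rel K k L) t)) g)
    (path_rep t g) by apply/path_rep_alg_eq/alg_repr_class.
move=> Ix; move: x Ix f; apply: finite_sums_sub => [f|x y Ix Iy f|].
- exact: repE.
- rewrite -{1}(alg_reprK x) -{1}(alg_reprK y) -alg_classD.
  apply: eventually_eq_trans (repE _ _) _.
  by apply: (eventually_eq2 (Ix f) (Iy f)) => m /= -> ->; rewrite addr0.
move=> _ [y [z [v [Hv ->]]]] f.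
have [y' ->] : exists y', y = alg_class _ y' by exists (alg_repr y); rewrite alg_reprK.
have [z' ->] : exists z', z = alg_class _ z' by exists (alg_repr z); rewrite alg_reprK.
rewrite /kp_mul /kp_vertex /kp_of_gen -!palg_mul_class.
apply: eventually_eq_trans (repE _ _) _ => /=.
have zero : eventually_eq (fun=> 0) (path_rep y' (fun=> 0)).
  exists 0 => m _ _; rewrite -[LHS](mul0r (path_rep y' (fun=> 0) m)) -path_repZ.
  by congr (path_rep _ _ _); apply: funext => n; rewrite mul0r.
apply: eventually_eq_sym; apply: eventually_eq_trans zero _.
apply/path_rep_eventually; exists 0 => m _ mH; case: eqP => // mv.
by case: mH; case: Hhs => h _; apply: h; rewrite mv.
Qed.

(** The test function is the constant 1: if [v] is outside [H], saturation gives arbitrarily long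
    paths with range [v] and source outside [H], where the projection at [v] returns 1. *)
Lemma kp_ideal_gen_trace : kp_vertex @^-1` kp_ideal_gen = H.
Proof.
apply/seteqP; split=> v /=; last first.
  by move=> Hv; apply: finite_sums_gen; exists (kp_vertex v), (kp_vertex v), v;
    rewrite !kp_vertex_idem.
move=> /(@kp_ideal_gen_rep _ (fun=> 1)) Iv; apply: contrapT => Hv.
have /eventually_eq_sym vE : eventually_eq
    (path_rep (alg_repr (kp_vertex v)) (fun=> 1 : K))
    (path_rep (AlgGen (KPp v)) (fun=> 1)).
  exact/path_rep_alg_eq/alg_repr_class.
have [N vN] := eventually_eq_trans vE Iv.
have [l [dl rl] lH] := unsaturated_path N Hhs Hv.
have /eqP := vN l (ex_intro _ 0 (etrans dl (esym (addr0 N)))) lH.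
by rewrite /= rl eqxx oner_eq0.
Qed.

End PathRepresentation.

(** * Graded prime ideals and their tails *)

Section GradedPrimes.
Context (K : fieldType) {k : nat} {L : kgraph k}.
Hypothesis hfin : row_finite L.

Lemma graded_ideal_system :
  ideal_system (@is_graded_ideal K k L) kp_vertex (@ideal_mul K k L).
Proof.
split.
- exact: graded_idealT.
- by move=> J [IJ _]; apply: ideal_trace_hs_kp.
- by move=> I J Ig [JI _]; apply: ideal_trace_sub_graded.
- move=> H Hhs; exists (kp_ideal_gen H); first exact: kp_ideal_gen_graded.
  exact: kp_ideal_gen_trace.
- exact: graded_ideal_mul.
- move=> I J [II _] [JI _]; apply/seteqP; split=> v /=.
    by move=> IJv; split; [apply: ideal_mul_sub_l IJv|apply: ideal_mul_sub_r IJv].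
  (* Idempotence of the projection writes it as a product of an element of [I] and one of [J]. *)
  move=> [Iv Jv]; apply: finite_sums_gen; exists (kp_vertex v) => //.
  by exists (kp_vertex v); rewrite ?kp_vertex_idem.
Qed.

Lemma gp_set_inj : injective (@gp_set K k L).
Proof.
by move=> [P Pp] [Q Qp] /= PQ; subst Q; rewrite (Prop_irrelevance Pp Qp).
Qed.

Lemma graded_prime_tail_model :
  tail_model (fun P : graded_prime K L => ~` (kp_vertex @^-1` gp_set P)).
Proof.
apply: (ideal_system_tail_model graded_ideal_system hfin) => //.
  exact: gp_set_inj.
by move=> P; split=> [Pp|[Q <-]]; [exists (GradedPrime Pp)|apply: gp_prop].
Qed.

End GradedPrimes.

Theorem theorem5p7 (k : nat) (hk : (1 <= k)%N) (L : kgraph k) (K : fieldType)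
    (hfin : row_finite L) (hsrc : without_sources L) :
  [/\ homeomorphic (maximal_tail L) (prime_filter L),
      homeomorphic (prime_filter L) (prime_order_ideal L) &
      homeomorphic (prime_order_ideal L) (graded_prime K L)] /\
  (finite_set [set: vertex L]%classic ->
    [/\ spectral_space (maximal_tail L),
        spectral_space (prime_filter L),
        spectral_space (prime_order_ideal L) &
        spectral_space (graded_prime K L)]).
Proof.
have tails := maximal_tail_model L.
have filters := prime_filter_tail_model hfin.
have ideals := order_ideal_tail_model hfin.
have primes := graded_prime_tail_model K hfin.
split=> [|finL]; split.
- exact: tail_model_homeomorphic tails filters.
- exact: tail_model_homeomorphic filters ideals.
- exact: tail_model_homeomorphic ideals primes.
- exact: tail_model_spectral tails finL.
- exact: tail_model_spectral filters finL.
- exact: tail_model_spectral ideals finL.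
- exact: tail_model_spectral primes finL.
Qed.
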